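(* Suppose that the following five identities hold for all complex $q$ with $0<|q|<1$: (i) $\displaystyle \sum_{m}(-1)^m\frac{q^{(5m^2+3m)/2}}{1-q^{5m+1}}-\sum_{m}(-1)^m\frac{q^{(5m^2-3m)/2}}{1-q^{5m-2}}=(q^5;q^5)_\infty^2\,\frac{G^2(q)}{H(q)}$; (ii) $\displaystyle \sum_{m}(-1)^m\frac{q^{(5m^2+5m)/2}}{1-q^{5m+1}}=(q^5;q^5)_\infty^2\,G(q)$; (iii) $\displaystyle \sum_{m}(-1)^m\frac{q^{(5m^2+5m)/2}}{1-q^{5m+2}}=(q^5;q^5)_\infty^2\,H(q)$; (iv) $\displaystyle -\sum_{m}(-1)^m\frac{q^{(5m^2+m-2)/2}}{1-q^{5m-1}}+\sum_{m}(-1)^m\frac{q^{(5m^2-m-2)/2}}{1-q^{5m-2}}=(q^5;q^5)_\infty^2\,\frac{H^2(q)}{G(q)}$; (v) $\displaystyle -{\sum_{m}}'(-1)^m\frac{q^{(5m^2+m-2)/2}}{1-q^{5m}}+\sum_{m}(-1)^m\frac{q^{(5m^2-m-2)/2}}{1-q^{5m-1}}+2{\sum_{m}}'(-1)^m\frac{q^{(5m^2+3m-2)/2}}{1-q^{5m}}+2\sum_{m}(-1)^m\frac{q^{(5m^2+7m)/2}}{1-q^{5m+2}}=(q^5;q^5)_\infty^2\,\frac{H^3(q)}{G^2(q)}$. Then for all such $q$, $$\frac{1}{(q;q)_\infty}\sum_{n\ge1}\frac{(-1)^nq^{\binom{n+1}{2}}(1-q^n)^3(1+q^n)}{1-q^{5n}}=-q(q^{25};q^{25})_\infty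 G(q^5)+q^2(q^{25};q^{25})_\infty H(q^5)+q^3(q^{25};q^{25})_\infty\frac{H^2(q^5)}{G(q^5)}.$$
   Context: Notation: $(A;q)_\infty=\prod_{m=0}^{\infty}(1-Aq^m)$. $\sum_m$ denotes the sum over all integers $m$, and $\sum_m'$ the sum over all nonzero integers $m$. $G(q)=\dfrac{1}{(q;q^5)_\infty(q^4;q^5)_\infty}$ and $H(q)=\dfrac{1}{(q^2;q^5)_\infty(q^3;q^5)_\infty}$. *)

(* Defs.v *)
From Stdlib Require Import Reals ZArith.
From Coquelicot Require Import Coquelicot.

Open Scope C_scope.

Definition Cpowz (z : C) (n : Z) : C :=
  match n with
  | Z0 => 1
  | Zpos p => z ^ Pos.to_nat p
  | Zneg p => / z ^ Pos.to_nat p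
  end.

(** Total limit and sum operators on [C], on the model of Coquelicot's [RInt]:
    the value is unspecified when the limit does not exist. *)
Definition CLim_seq (u : nat -> C) : C :=
  iota (T := C_CompleteNormedModule)
    (fun l : C => filterlim u eventually (locally l)).

Definition CSeries (a : nat -> C) : C :=
  iota (T := C_CompleteNormedModule)
    (fun l : C => is_series (V := C_NormedModule) a l).

(** Bilateral sums. Splitting at the origin requires both halves to converge,
    so this is not a principal value; all the series to which these operators
    are applied converge absolutely. *)
Definition Zsum' (f : Z -> C) : C :=
  CSeries (fun n => f (Z.of_nat (S n))) +
  CSeries (fun n => f (- Z.of_nat (S n))%Z).

Definition Zsum (f : Z -> C) : C :=
  CSeries (fun n => f (Z.of_nat n)) +
  CSeries (fun n => f (- Z.of_nat (S n))%Z).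

Fixpoint qpoch_n (A q : C) (n : nat) : C :=
  match n with
  | O => 1
  | S m => qpoch_n A q m * (1 - A * q ^ m)
  end.

(** [qpoch A q] is (A; q)_oo. *)
Definition qpoch (A q : C) : C := CLim_seq (qpoch_n A q).

(** The Rogers-Ramanujan functions G and H. *)
Definition rrG (q : C) : C := 1 / (qpoch q (q ^ 5) * qpoch (q ^ 4) (q ^ 5)).
Definition rrH (q : C) : C := 1 / (qpoch (q ^ 2) (q ^ 5) * qpoch (q ^ 3) (q ^ 5)).

Definition in_punctured_disc (q : C) : Prop := (0 < Cmod q < 1)%R.

(* Main.v *)
(** Since [(1 - x)^3 (1 + x) = 1 - 2 x + 2 x^3 - x^4], pairing [n] with [-n] turns the
    series into the bilateral sum of [(-1)^n q^(n(n+1)/2) (1 - 2 q^n) / (1 - q^(5n))].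
    Splitting it by [n] modulo 5 and applying the five hypotheses at [q^5] expresses it
    through [G = G(q^5)] and [H = H(q^5)]; dividing by [(q; q)_oo] then only requires
      [(q; q)_oo = (q^25; q^25)_oo (G / H - q - q^2 H / G)].
    For that, let [z] be a primitive fifth root of unity and [a = z + 1/z], so [a^2 + a = 1].
    The triple product gives [sum (-1)^n z^n q^(n(n+1)/2)] as a product; splitting the sum
    modulo 5 shows
      [theta1 - (1 + a) q theta2 = (q; q)_oo (z q; q)_oo (q / z; q)_oo],
    where [theta1 = (q^5; q^5)_oo G] and [theta2 = (q^5; q^5)_oo H], again by the triple
    product. Multiplying the two equations obtained from the two roots [a] yields
      [(q; q)_oo (q^5; q^5)_oo = theta1^2 - q theta1 theta2 - q^2 theta2^2].
    The triple product itself is the limit, by dominated convergence, of its finite form. *)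

Require Import Defs.
From Stdlib Require Import Reals ZArith Lra Lia FunctionalExtensionality.
From Coquelicot Require Import Coquelicot.
Open Scope C_scope.

(** * Limits and bilateral sums *)

(** Phrased through the real sequence of distances, so that real squeeze and limit arithmetic apply
    directly to complex sequences. *)
Definition Clim (u : nat -> C) (l : C) : Prop :=
  is_lim_seq (fun n => Cmod (u n - l)) 0.

Fixpoint psum (a : nat -> C) (n : nat) : C :=
  match n with O => 0 | S m => psum a m + a m end.

Lemma Clim_filterlim (u : nat -> C) (l : C) :
  Clim u l <-> filterlim u eventually (locally l).
Proof.
  unfold Clim; rewrite <- is_lim_seq_spec; split.
  - intros H. apply (filterlim_locally_ball_norm (U := C_NormedModule)).
    intros eps. destruct (H eps) as [N HN]. exists N; intros n Hn.
    specialize (HN n Hn). rewrite Rminus_0_r, Rabs_right in HN.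
    + exact HN.
    + apply Rle_ge, Cmod_ge_0.
  - intros H eps.
    destruct (proj1 (filterlim_locally_ball_norm (U := C_NormedModule) u l) H eps) as [N HN].
    exists N; intros n Hn. rewrite Rminus_0_r, Rabs_right.
    + exact (HN n Hn).
    + apply Rle_ge, Cmod_ge_0.
Qed.

Lemma CLim_seq_eq (u : nat -> C) (l : C) : Clim u l -> CLim_seq u = l.
Proof.
  intros H. apply (iota_filterlim_locally (V := C_CompleteNormedModule)).
  now apply Clim_filterlim.
Qed.

Lemma Clim_ext (u v : nat -> C) (l : C) :
  (forall n, u n = v n) -> Clim u l -> Clim v l.
Proof. intros E; apply is_lim_seq_ext; intros n; now rewrite E. Qed.

Lemma Clim_le (u : nat -> C) (l : C) (w : nat -> R) :
  (forall n, (Cmod (u n - l) <= w n)%R) -> is_lim_seq w 0 -> Clim u l.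
Proof.
  intros H Hw. apply is_lim_seq_le_le with (fun _ => 0%R) w; trivial.
  - intros n; split; [apply Cmod_ge_0 | apply H].
  - apply is_lim_seq_const.
Qed.

Lemma Clim_unique (u : nat -> C) (l l' : C) : Clim u l -> Clim u l' -> l = l'.
Proof.
  intros H H'. rewrite <- (CLim_seq_eq _ _ H). now apply CLim_seq_eq.
Qed.

Lemma Clim_const (c : C) : Clim (fun _ => c) c.
Proof.
  apply Clim_le with (fun _ => 0%R); [|apply is_lim_seq_const].
  intros _. replace (c - c) with (RtoC 0) by ring. rewrite Cmod_0; lra.
Qed.

Lemma Clim_plus (u v : nat -> C) (l l' : C) :
  Clim u l -> Clim v l' -> Clim (fun n => u n + v n) (l + l').
Proof.
  intros H H'. apply Clim_le with (fun n => (Cmod (u n - l)%C + Cmod (v n - l')%C)%R).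
  - intros n. replace (u n + v n - (l + l')) with ((u n - l) + (v n - l')) by ring.
    apply Cmod_triangle.
  - rewrite <- (Rplus_0_r 0). now apply is_lim_seq_plus'.
Qed.

Lemma Clim_bounded (u : nat -> C) (l : C) :
  Clim u l -> exists M : R, forall n, (Cmod (u n) <= M)%R.
Proof.
  intros H%Clim_filterlim.
  destruct (filterlim_bounded (V := C_NormedModule) u) as [M HM]; [now exists l|].
  now exists M.
Qed.

Lemma Clim_mult (u v : nat -> C) (l l' : C) :
  Clim u l -> Clim v l' -> Clim (fun n => u n * v n) (l * l').
Proof.
  intros H H'. destruct (Clim_bounded _ _ H) as [M HM].
  apply Clim_le with (fun n => (M * Cmod (v n - l')%C + Cmod l' * Cmod (u n - l)%C)%R).
  - intros n.
    replace (u n * v n - l * l') with (u n * (v n - l') + l' * (u n - l)) by ring.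
    eapply Rle_trans; [apply Cmod_triangle|]. rewrite !Cmod_mult.
    apply Rplus_le_compat_r, Rmult_le_compat_r; [apply Cmod_ge_0 | apply HM].
  - replace 0%R with (M * 0 + Cmod l' * 0)%R by ring.
    apply is_lim_seq_plus'; apply is_lim_seq_mult'; trivial; apply is_lim_seq_const.
Qed.

(** With [u] and [l] bounded away from zero, [1/u - 1/l = -(u - l)/(u l)] is at most a constant
    times [|u - l|]. The uniform bound [c] will come from [qpoch_n_ge]. *)
Lemma Clim_inv (u : nat -> C) (l : C) (c : R) :
  (0 < c)%R -> (forall n, (c <= Cmod (u n))%R) -> l <> 0 ->
  Clim u l -> Clim (fun n => / u n) (/ l).
Proof.
  intros Hc Hu Hl H.
  assert (Hu0 : forall n, u n <> 0).
  { intros n. apply Cmod_gt_0. specialize (Hu n); lra. }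
  pose proof (proj1 (Cmod_gt_0 l) Hl) as Hl'.
  apply Clim_le with (fun n => (/ c * / Cmod l * Cmod (u n - l)%C)%R).
  - intros n. replace (/ u n - / l) with (/ u n * / l * - (u n - l)) by (field; auto).
    rewrite !Cmod_mult, Cmod_opp, !Cmod_inv by auto.
    apply Rmult_le_compat_r; [apply Cmod_ge_0|].
    apply Rmult_le_compat_r; [apply Rlt_le, Rinv_0_lt_compat; lra|].
    apply Rinv_le_contravar; auto.
  - rewrite <- (Rmult_0_r (/ c * / Cmod l)).
    apply is_lim_seq_mult'; trivial; apply is_lim_seq_const.
Qed.

Lemma Clim_subseq (u : nat -> C) (l : C) (phi : nat -> nat) :
  (forall n, n <= phi n)%nat -> Clim u l -> Clim (fun n => u (phi n)) l.
Proof.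
  unfold Clim; rewrite <- !is_lim_seq_spec; intros Hphi H eps.
  destruct (H eps) as [N HN]. exists N; intros n Hn. apply HN.
  specialize (Hphi n); lia.
Qed.

Lemma Clim_decr_n (u : nat -> C) (l : C) (k : nat) :
  Clim (fun n => u (n + k)%nat) l -> Clim u l.
Proof. intros H. apply (is_lim_seq_incr_n (fun n => Cmod (u n - l)) k), H. Qed.

(** * Partial sums and dominated convergence *)

Lemma psum_sum_n (a : nat -> C) (n : nat) :
  psum a (S n) = sum_n (G := C_AbelianMonoid) a n.
Proof.
  induction n as [|n IH].
  - rewrite sum_O; simpl; ring.
  - rewrite sum_Sn, <- IH. reflexivity.
Qed.

Lemma Clim_psum_is_series (a : nat -> C) (l : C) :
  Clim (psum a) l <-> is_series (V := C_NormedModule) a l.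
Proof.
  unfold is_series; rewrite <- Clim_filterlim.
  unfold Clim; rewrite is_lim_seq_incr_1.
  split; apply is_lim_seq_ext; intros n; now rewrite psum_sum_n.
Qed.

Lemma CSeries_eq (a : nat -> C) (l : C) : Clim (psum a) l -> CSeries a = l.
Proof.
  intros H%Clim_psum_is_series.
  apply (iota_filterlim_locally (V := C_CompleteNormedModule) (F := eventually)), H.
Qed.

(** Comparison with a geometric series: completeness of [C] provides a sum, and uniqueness of limits
    identifies it with [CSeries a]. *)
Lemma psum_geom_Clim (a : nat -> C) (K r : R) :
  (0 <= r < 1)%R -> (forall n, (Cmod (a n) <= K * r ^ n)%R) ->
  Clim (psum a) (CSeries a).
Proof.
  intros Hr Ha.
  destruct (ex_series_le (V := C_CompleteNormedModule) a (fun n => K * r ^ n)%R) as [l Hl].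
  - exact Ha.
  - apply (ex_series_scal (K := R_AbsRing) (V := R_NormedModule)), ex_series_geom.
    rewrite Rabs_right; lra.
  - apply Clim_psum_is_series in Hl. now rewrite (CSeries_eq _ _ Hl).
Qed.

Lemma psum_plus (a b : nat -> C) (n : nat) :
  psum (fun k => a k + b k) n = psum a n + psum b n.
Proof. induction n as [|n IH]; simpl; [|rewrite IH]; ring. Qed.

Lemma psum_scal (c : C) (a : nat -> C) (n : nat) :
  psum (fun k => c * a k) n = c * psum a n.
Proof. induction n as [|n IH]; simpl; [|rewrite IH]; ring. Qed.

Lemma psum_ext (a b : nat -> C) (n : nat) :
  (forall k, a k = b k) -> psum a n = psum b n.
Proof. intros E; induction n as [|n IH]; simpl; congruence. Qed.

Lemma psum_telescope (u : nat -> C) (n : nat) :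
  psum (fun k => u (S k) - u k) n = u n - u 0%nat.
Proof. induction n as [|n IH]; simpl; [|rewrite IH]; ring. Qed.

Lemma pow_antitone (r : R) (m n : nat) : (0 <= r < 1)%R -> (m <= n)%nat -> (r ^ n <= r ^ m)%R.
Proof.
  intros Hr; induction 1 as [|n Hn IH]; [lra|].
  simpl. pose proof (pow_le r n (proj1 Hr)). nra.
Qed.

Lemma psum_tail_le (a : nat -> C) (K r : R) (N p : nat) :
  (0 <= r < 1)%R -> (forall k, (Cmod (a k) <= K * r ^ k)%R) ->
  (Cmod (psum a (N + p) - psum a N) <= K * r ^ N / (1 - r))%R.
Proof.
  intros Hr Ha.
  assert (HK : (0 <= K * r ^ N)%R).
  { eapply Rle_trans; [apply Cmod_ge_0 | apply Ha]. }
  (* The exact finite geometric sum is the bound that survives induction on [p]. *)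
  assert (H : (Cmod (psum a (N + p) - psum a N) <= K * r ^ N * ((1 - r ^ p) / (1 - r)))%R).
  { induction p as [|p IH].
    - rewrite Nat.add_0_r. replace (psum a N - psum a N) with (RtoC 0) by ring.
      rewrite Cmod_0. simpl. right; field; lra.
    - rewrite Nat.add_succ_r. simpl psum.
      replace (psum a (N + p) + a (N + p)%nat - psum a N)
        with ((psum a (N + p) - psum a N) + a (N + p)%nat) by ring.
      eapply Rle_trans; [apply Cmod_triangle|].
      replace (K * r ^ N * ((1 - r ^ S p) / (1 - r)))%R
        with (K * r ^ N * ((1 - r ^ p) / (1 - r)) + K * r ^ (N + p))%R
        by (rewrite pow_add; simpl; field; lra).
      apply Rplus_le_compat; trivial. }
  eapply Rle_trans; [exact H|].
  apply Rmult_le_compat_l; trivial.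
  rewrite <- (Rmult_1_l (/ (1 - r))).
  apply Rmult_le_compat_r; [apply Rlt_le, Rinv_0_lt_compat; lra|].
  pose proof (pow_le r p (proj1 Hr)); lra.
Qed.

(** Cut at a fixed [N]: the tail is small uniformly in [n] by domination, and the head is a finite
    sum of null sequences. *)
Lemma psum_dominated_Clim (a : nat -> nat -> C) (K r : R) :
  (0 <= r < 1)%R -> (forall n k, (Cmod (a n k) <= K * r ^ k)%R) ->
  (forall k, Clim (fun n => a n k) 0) ->
  Clim (fun n => psum (a n) (S n)) 0.
Proof.
  intros Hr Ha Hk.
  assert (Hfix : forall N, Clim (fun n => psum (a n) N) 0).
  { induction N as [|N IH]; simpl; [apply Clim_const|].
    replace (RtoC 0) with (RtoC 0 + RtoC 0) by ring. now apply Clim_plus. }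
  assert (Htail : is_lim_seq (fun N => K * r ^ N / (1 - r))%R 0).
  { replace 0%R with (K * 0 * / (1 - r))%R by (field; lra).
    apply is_lim_seq_mult'; [|apply is_lim_seq_const].
    apply is_lim_seq_mult'; [apply is_lim_seq_const|].
    apply is_lim_seq_geom. rewrite Rabs_right; lra. }
  unfold Clim in *; rewrite <- is_lim_seq_spec; intros eps.
  assert (He : (0 < eps / 2)%R) by (pose proof (cond_pos eps); lra).
  rewrite <- is_lim_seq_spec in Htail.
  destruct (Htail (mkposreal _ He)) as [N HN]. simpl in HN.
  specialize (Hfix N). rewrite <- is_lim_seq_spec in Hfix.
  destruct (Hfix (mkposreal _ He)) as [N' HN']. simpl in HN'.
  exists (max N N'); intros n Hn.
  specialize (HN N (le_n N)). specialize (HN' n ltac:(lia)).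
  rewrite Rminus_0_r in *.
  rewrite Rabs_right by apply Rle_ge, Cmod_ge_0.
  replace (S n) with (N + (S n - N))%nat by lia.
  replace (psum (a n) (N + (S n - N)) - 0)
    with ((psum (a n) (N + (S n - N)) - psum (a n) N) + (psum (a n) N - 0)) by ring.
  eapply Rle_lt_trans; [apply Cmod_triangle|].
  pose proof (psum_tail_le (a n) K r N (S n - N) Hr (Ha n)) as T.
  pose proof (Rle_abs (K * r ^ N / (1 - r))). pose proof (Rle_abs (Cmod (psum (a n) N - 0))). lra.
Qed.

(** * Bilateral sums through finite windows *)

Definition zpair (f : Z -> C) (k : nat) : C := f (Z.of_nat k) + f (- Z.of_nat (S k))%Z.

(** The window of length [2n] from [-n] to [n - 1]. It is stable under [m -> -1 - m], and a window
    of length [10n] splits evenly into residue classes modulo 5. *)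
Definition zpsum (f : Z -> C) : nat -> C := psum (zpair f).

Definition geom_bounded (r : R) (f : Z -> C) : Prop :=
  exists K : R, forall m : Z, (Cmod (f m) <= K * r ^ Z.abs_nat m)%R.

Lemma geom_bounded_plus (r : R) (f g : Z -> C) :
  geom_bounded r f -> geom_bounded r g -> geom_bounded r (fun m => f m + g m).
Proof.
  intros [K HK] [L HL]. exists (K + L)%R; intros m.
  eapply Rle_trans; [apply Cmod_triangle|]. specialize (HK m); specialize (HL m); lra.
Qed.

Lemma geom_bounded_mult (r : R) (c f : Z -> C) (M : R) :
  (0 <= r)%R -> (forall m, (Cmod (c m) <= M)%R) ->
  geom_bounded r f -> geom_bounded r (fun m => c m * f m).
Proof.
  intros Hr HM [K HK]. exists (M * K)%R; intros m.
  rewrite Cmod_mult, Rmult_assoc.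
  apply Rmult_le_compat; auto using Cmod_ge_0.
Qed.

Lemma geom_bounded_scal (r : R) (c : C) (f : Z -> C) :
  (0 <= r)%R -> geom_bounded r f -> geom_bounded r (fun m => c * f m).
Proof.
  intros Hr. apply geom_bounded_mult with (M := Cmod c); auto using Rle_refl.
Qed.

Lemma geom_bounded_ext (r : R) (f g : Z -> C) :
  (forall m, f m = g m) -> geom_bounded r f -> geom_bounded r g.
Proof. intros E [K HK]; exists K; intros m; now rewrite <- E. Qed.

Section BilateralSums.
Variable r : R.
Hypothesis Hr : (0 <= r < 1)%R.

Lemma geom_bounded_pos (f : Z -> C) :
  geom_bounded r f ->
  exists K, forall n : nat, (Cmod (f (Z.of_nat n)) <= K * r ^ n)%R
                        /\ (Cmod (f (- Z.of_nat n)%Z) <= K * r ^ n)%R.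
Proof.
  intros [K HK]; exists K; intros n; split.
  - specialize (HK (Z.of_nat n)). now rewrite Zabs2Nat.id in HK.
  - specialize (HK (- Z.of_nat n)%Z). now replace (Z.abs_nat (- Z.of_nat n)) with n in HK by lia.
Qed.

Lemma is_lim_seq_geom_mult (K : R) : is_lim_seq (fun n => K * r ^ n)%R 0.
Proof.
  rewrite <- (Rmult_0_r K). apply is_lim_seq_mult'; [apply is_lim_seq_const|].
  apply is_lim_seq_geom. rewrite Rabs_right; lra.
Qed.

Lemma geom_bounded_Clim_pos (f : Z -> C) :
  geom_bounded r f -> Clim (fun n => f (Z.of_nat n)) 0.
Proof.
  intros [K HK]%geom_bounded_pos.
  apply Clim_le with (fun n => K * r ^ n)%R; [|apply is_lim_seq_geom_mult].
  intros n. replace (f (Z.of_nat n) - 0) with (f (Z.of_nat n)) by ring. apply HK.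
Qed.

Lemma geom_bounded_Clim_neg (f : Z -> C) :
  geom_bounded r f -> Clim (fun n => f (- Z.of_nat n)%Z) 0.
Proof.
  intros [K HK]%geom_bounded_pos.
  apply Clim_le with (fun n => K * r ^ n)%R; [|apply is_lim_seq_geom_mult].
  intros n. replace (f (- Z.of_nat n)%Z - 0) with (f (- Z.of_nat n)%Z) by ring. apply HK.
Qed.

(** Both one-sided series converge, so their sum is the limit over windows. Identities between
    bilateral sums thereby reduce to identities between finite sums. *)
Lemma zpsum_Clim (f : Z -> C) : geom_bounded r f -> Clim (zpsum f) (Zsum f).
Proof.
  intros [K HK]%geom_bounded_pos.
  apply Clim_ext with (fun n => psum (fun n => f (Z.of_nat n)) n
                                + psum (fun n => f (- Z.of_nat (S n))%Z) n).
  - intros n. now rewrite <- psum_plus.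
  - apply Clim_plus.
    + apply psum_geom_Clim with K r; trivial. intros n; apply HK.
    (* The negative half starts at [-1], which contributes one extra factor [r]. *)
    + apply psum_geom_Clim with (K * r)%R r; trivial. intros n.
      rewrite Rmult_assoc. apply (HK (S n)).
Qed.

Lemma Zsum_eq (f : Z -> C) (l : C) : geom_bounded r f -> Clim (zpsum f) l -> Zsum f = l.
Proof. intros Hf. apply Clim_unique. now apply zpsum_Clim. Qed.

Lemma Zsum_scal (c : C) (f : Z -> C) :
  geom_bounded r f -> Zsum (fun m => c * f m) = c * Zsum f.
Proof.
  intros Hf. apply Zsum_eq; [apply geom_bounded_scal; trivial; lra|].
  apply Clim_ext with (fun n => c * zpsum f n).
  - intros n. unfold zpsum. rewrite <- psum_scal. apply psum_ext; intros k.
    unfold zpair; ring.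
  - apply Clim_mult; [apply Clim_const | now apply zpsum_Clim].
Qed.

Lemma Zsum_plus (f g : Z -> C) :
  geom_bounded r f -> geom_bounded r g ->
  Zsum (fun m => f m + g m) = Zsum f + Zsum g.
Proof.
  intros Hf Hg. apply Zsum_eq; [now apply geom_bounded_plus|].
  apply Clim_ext with (fun n => zpsum f n + zpsum g n).
  - intros n. unfold zpsum. rewrite <- psum_plus. apply psum_ext; intros k.
    unfold zpair; ring.
  - apply Clim_plus; now apply zpsum_Clim.
Qed.

Lemma zpsum_lin (a b c : C) (f g h : Z -> C) (n : nat) :
  zpsum (fun m => a * f m + b * g m + c * h m) n
  = a * zpsum f n + b * zpsum g n + c * zpsum h n.
Proof.
  unfold zpsum. rewrite <- !psum_scal, <- !psum_plus. apply psum_ext; intros k.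
  unfold zpair; ring.
Qed.

(* Tannery's theorem. *)
Lemma zpsum_dominated_Clim (t : Z -> C) (c : nat -> Z -> C) (M : R) (l : C) :
  geom_bounded r t -> (forall n j, (Cmod (c n j) <= M)%R) ->
  (forall j, Clim (fun n => c n j) l) ->
  Clim (fun n => zpsum (fun j => t j * c n j) (S n)) (l * Zsum t).
Proof.
  intros Ht HM Hc.
  (* Subtracting the limit from the coefficients leaves null sequences dominated by [t], plus a
     multiple of the windows of [t]. *)
  apply Clim_ext with (fun n => zpsum (fun j => t j * (c n j - l)) (S n) + l * zpsum t (S n)).
  { intros n. unfold zpsum. rewrite <- psum_scal, <- psum_plus.
    apply psum_ext; intros k. unfold zpair; ring. }
  replace (l * Zsum t) with (0 + l * Zsum t) by ring. apply Clim_plus.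
  - destruct (geom_bounded_pos _ Ht) as [K HK].
    assert (HK0 : (0 <= K)%R).
    { eapply Rle_trans; [apply Cmod_ge_0|]. destruct (HK 0%nat) as [HK' _].
      rewrite <- (Rmult_1_r K). exact HK'. }
    assert (Hd : forall n j, (Cmod (c n j - l) <= M + Cmod l)%R).
    { intros n j. eapply Rle_trans; [apply Cmod_triangle|]. rewrite Cmod_opp.
      apply Rplus_le_compat_r, HM. }
    unfold zpsum. apply psum_dominated_Clim with (2 * K * (M + Cmod l))%R r; trivial.
    + intros n k. unfold zpair. eapply Rle_trans; [apply Cmod_triangle|].
      rewrite !Cmod_mult.
      assert (H1 := HK k). assert (H2 := HK (S k)).
      replace (2 * K * (M + Cmod l) * r ^ k)%R
        with (K * r ^ k * (M + Cmod l) + K * r ^ k * (M + Cmod l))%R by ring.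
      apply Rplus_le_compat; apply Rmult_le_compat; auto using Cmod_ge_0.
      * apply H1.
      * eapply Rle_trans; [apply H2|]. apply Rmult_le_compat_l; trivial.
        apply pow_antitone; [exact Hr | lia].
    + intros k. unfold zpair.
      assert (H0 : forall j, Clim (fun n => t j * (c n j - l)) 0).
      { intros j. replace (RtoC 0) with (t j * (l - l)) by ring.
        apply Clim_mult; [apply Clim_const|].
        apply Clim_plus; [apply Hc | apply Clim_const]. }
      replace (RtoC 0) with (RtoC 0 + RtoC 0) by ring. now apply Clim_plus.
  - apply Clim_mult; [apply Clim_const|].
    apply Clim_subseq; [intros; lia | now apply zpsum_Clim].
Qed.

(** The window moves one step to the right: it gains the index [n] and loses [-n]. *)
Lemma zpsum_succ (f : Z -> C) (n : nat) :
  zpsum (fun m => f (m + 1)%Z) n = zpsum f n + f (Z.of_nat n) - f (- Z.of_nat n)%Z.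
Proof.
  induction n as [|n IH]; [unfold zpsum; simpl; ring|].
  unfold zpsum in *; simpl psum; rewrite IH. unfold zpair.
  replace (Z.of_nat n + 1)%Z with (Z.of_nat (S n)) by lia.
  replace (- Z.of_nat (S n) + 1)%Z with (- Z.of_nat n)%Z by lia. ring.
Qed.

Lemma zpsum_pred (f : Z -> C) (n : nat) :
  zpsum (fun m => f (m - 1)%Z) n
  = zpsum f n + f (- Z.of_nat (S n))%Z - f (Z.of_nat n - 1)%Z.
Proof.
  induction n as [|n IH]; [unfold zpsum; simpl; ring|].
  unfold zpsum in *; simpl psum; rewrite IH. unfold zpair.
  replace (Z.of_nat (S n) - 1)%Z with (Z.of_nat n) by lia.
  replace (- Z.of_nat (S n) - 1)%Z with (- Z.of_nat (S (S n)))%Z by lia. ring.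
Qed.

Lemma Zsum_succ (f : Z -> C) :
  geom_bounded r f -> geom_bounded r (fun m => f (m + 1)%Z) ->
  Zsum (fun m => f (m + 1)%Z) = Zsum f.
Proof.
  intros Hf Hs. apply Zsum_eq; trivial.
  apply Clim_ext with (fun n => zpsum f n + (f (Z.of_nat n) + (- (1)) * f (- Z.of_nat n)%Z)).
  - intros n. rewrite zpsum_succ; ring.
  - replace (Zsum f) with (Zsum f + (0 + (- (1)) * 0)) by ring.
    apply Clim_plus; [now apply zpsum_Clim|]. apply Clim_plus.
    + now apply geom_bounded_Clim_pos.
    + apply Clim_mult; [apply Clim_const | now apply geom_bounded_Clim_neg].
Qed.

(** Since [|m| <= |m - 1| + 1], the shift costs a factor [1/r] in the constant. *)
Lemma geom_bounded_pred (f : Z -> C) :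
  (0 < r)%R -> geom_bounded r f -> geom_bounded r (fun m => f (m - 1)%Z).
Proof.
  intros Hr0 [K HK]. exists (K * / r)%R; intros m.
  assert (HK0 : (0 <= K)%R).
  { specialize (HK 0%Z). pose proof (Cmod_ge_0 (f 0%Z)). simpl in HK; lra. }
  eapply Rle_trans; [apply HK|]. rewrite Rmult_assoc. apply Rmult_le_compat_l; trivial.
  apply Rmult_le_reg_l with r; trivial.
  replace (r * (/ r * r ^ Z.abs_nat m))%R with (r ^ Z.abs_nat m)%R by (field; lra).
  rewrite tech_pow_Rmult. apply pow_antitone; trivial; lia.
Qed.

Lemma Zsum_pred (f : Z -> C) :
  (0 < r)%R -> geom_bounded r f -> Zsum f = Zsum (fun m => f (m - 1)%Z).
Proof.
  intros Hr0 Hf.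
  assert (E : forall m, f (m + 1 - 1)%Z = f m) by (intros m; f_equal; lia).
  transitivity (Zsum (fun m => f (m + 1 - 1)%Z)).
  - f_equal. apply functional_extensionality; intros m; now rewrite E.
  - apply (Zsum_succ (fun m => f (m - 1)%Z)); [now apply geom_bounded_pred|].
    now apply geom_bounded_ext with f.
Qed.

Lemma Zsum'_Zsum (f : Z -> C) : geom_bounded r f -> f 0%Z = 0 -> Zsum' f = Zsum f.
Proof.
  intros [K HK]%geom_bounded_pos H0. unfold Zsum', Zsum. f_equal.
  apply CSeries_eq.
  apply Clim_ext with (fun n => psum (fun k => f (Z.of_nat k)) (S n)).
  - induction n as [|n IH]; cbn [psum] in *; [simpl Z.of_nat; rewrite H0; ring|].
    now rewrite IH.
  - apply Clim_subseq; [intros; lia|]. apply psum_geom_Clim with K r; trivial. apply HK.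
Qed.

(** Pairing [n] with [-n] covers the window from [-n] to [n], one vanishing boundary term more than
    [zpsum]. This turns the one-sided series of the theorem into a bilateral sum. *)
Lemma CSeries_pairs (f : Z -> C) :
  geom_bounded r f -> f 0%Z = 0 ->
  CSeries (fun k => f (Z.of_nat (S k)) + f (- Z.of_nat (S k))%Z) = Zsum f.
Proof.
  intros Hf H0. apply CSeries_eq.
  apply Clim_ext with (fun n => zpsum f n + f (Z.of_nat n)).
  - intros n. unfold zpsum, zpair.
    induction n as [|n IH]; cbn [psum] in *; [simpl Z.of_nat; rewrite H0; ring|].
    rewrite <- IH. ring.
  - replace (Zsum f) with (Zsum f + 0) by ring.
    apply Clim_plus; [now apply zpsum_Clim | now apply geom_bounded_Clim_pos].
Qed.

Lemma zpsum_split5 (f : Z -> C) (n : nat) :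
  zpsum f (5 * n) =
    zpsum (fun m => f (5 * m)%Z) n + zpsum (fun m => f (5 * m + 1)%Z) n
    + zpsum (fun m => f (5 * m + 2)%Z) n + zpsum (fun m => f (5 * m + 3)%Z) n
    + zpsum (fun m => f (5 * m + 4)%Z) n.
Proof.
  induction n as [|n IH]; [unfold zpsum; simpl; ring|].
  replace (5 * S n)%nat with (S (S (S (S (S (5 * n)))))) by lia.
  unfold zpsum in *; cbn [psum]; rewrite IH. unfold zpair.
  replace (Z.of_nat (S (S (S (S (5 * n))))))%Z with (5 * Z.of_nat n + 4)%Z by lia.
  replace (Z.of_nat (S (S (S (5 * n)))))%Z with (5 * Z.of_nat n + 3)%Z by lia.
  replace (Z.of_nat (S (S (5 * n))))%Z with (5 * Z.of_nat n + 2)%Z by lia.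
  replace (Z.of_nat (S (5 * n)))%Z with (5 * Z.of_nat n + 1)%Z by lia.
  replace (Z.of_nat (5 * n))%Z with (5 * Z.of_nat n)%Z by lia.
  (* Negative indices are written with remainders from 0 to 4, so each class receives exactly one
     new term at [-(n + 1)]. *)
  replace (- Z.of_nat (S (S (S (S (S (5 * n)))))))%Z with (5 * - Z.of_nat (S n))%Z by lia.
  replace (- (5 * Z.of_nat n + 4))%Z with (5 * - Z.of_nat (S n) + 1)%Z by lia.
  replace (- (5 * Z.of_nat n + 3))%Z with (5 * - Z.of_nat (S n) + 2)%Z by lia.
  replace (- (5 * Z.of_nat n + 2))%Z with (5 * - Z.of_nat (S n) + 3)%Z by lia.
  replace (- (5 * Z.of_nat n + 1))%Z with (5 * - Z.of_nat (S n) + 4)%Z by lia.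
  ring.
Qed.

(** For remainders from 0 to 4 one has [|m| <= |5m + j|], the tight case being [m = -1], [j = 4]. *)
Lemma geom_bounded_comp5 (f : Z -> C) (j : Z) :
  (0 <= j <= 4)%Z -> geom_bounded r f -> geom_bounded r (fun m => f (5 * m + j)%Z).
Proof.
  intros Hj [K HK]. exists K; intros m.
  assert (HK0 : (0 <= K)%R).
  { specialize (HK 0%Z). pose proof (Cmod_ge_0 (f 0%Z)). simpl in HK; lra. }
  eapply Rle_trans; [apply HK|]. apply Rmult_le_compat_l; trivial.
  apply pow_antitone; trivial; lia.
Qed.

Lemma Zsum_split5 (f : Z -> C) :
  geom_bounded r f ->
  Zsum f = Zsum (fun m => f (5 * m)%Z) + Zsum (fun m => f (5 * m + 1)%Z)
    + Zsum (fun m => f (5 * m + 2)%Z) + Zsum (fun m => f (5 * m + 3)%Z)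
    + Zsum (fun m => f (5 * m + 4)%Z).
Proof.
  intros Hf.
  apply Clim_unique with (fun n => zpsum f (5 * n)).
  - apply Clim_subseq; [intros; lia | now apply zpsum_Clim].
  - eapply Clim_ext; [intros n; symmetry; apply zpsum_split5|].
    repeat apply Clim_plus; apply zpsum_Clim; try (apply geom_bounded_comp5; trivial; lia).
    apply geom_bounded_ext with (fun m => f (5 * m + 0)%Z).
    + intros m; f_equal; lia.
    + apply geom_bounded_comp5; trivial; lia.
Qed.

End BilateralSums.

Lemma Zsum_ext (f g : Z -> C) : (forall m, f m = g m) -> Zsum f = Zsum g.
Proof.
  intros E. replace f with g; trivial.
  apply functional_extensionality. intros m; now rewrite E.
Qed.

(** The reflection [m -> -1 - m] exchanges the two one-sided series term by term. *)
Lemma Zsum_reflect (f : Z -> C) : Zsum (fun m => f (- 1 - m)%Z) = Zsum f.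
Proof.
  unfold Zsum. rewrite Cplus_comm.
  f_equal; f_equal; apply functional_extensionality; intros n; f_equal; lia.
Qed.

(** Reflection gives [S = -S]. This removes the residue class 2 modulo 5 in the dissection. *)
Lemma Zsum_antisymmetric (r : R) (f : Z -> C) :
  (0 <= r < 1)%R -> geom_bounded r f -> (forall m, f (- 1 - m)%Z = - f m) -> Zsum f = 0.
Proof.
  intros Hr Hf E.
  assert (H : Zsum f = -1 * Zsum f).
  { rewrite <- (Zsum_scal r) by trivial. rewrite <- Zsum_reflect.
    apply Zsum_ext; intros m. rewrite E. ring. }
  replace (Zsum f) with ((Zsum f - -1 * Zsum f) / 2) by field.
  rewrite <- H. field.
Qed.

(** * Integer powers and infinite products *)

Lemma Cpowz_of_nat (z : C) (n : nat) : Cpowz z (Z.of_nat n) = z ^ n.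
Proof. destruct n as [|n]; trivial. simpl Cpowz. now rewrite SuccNat2Pos.id_succ. Qed.

Lemma Cpowz_opp_nat (z : C) (n : nat) : z <> 0 -> Cpowz z (- Z.of_nat n) = / z ^ n.
Proof.
  intros Hz; destruct n as [|n].
  - simpl; field.
  - simpl Cpowz. now rewrite SuccNat2Pos.id_succ.
Qed.

Lemma Cpowz_succ (z : C) (m : Z) : z <> 0 -> Cpowz z (m + 1) = z * Cpowz z m.
Proof.
  intros Hz. destruct (Z_lt_le_dec m 0) as [Hm|Hm].
  - replace m with (- Z.of_nat (S (Z.to_nat (- m - 1))))%Z by lia.
    set (n := Z.to_nat (- m - 1)).
    replace (- Z.of_nat (S n) + 1)%Z with (- Z.of_nat n)%Z by lia.
    rewrite !Cpowz_opp_nat, Cpow_S by trivial.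
    field. auto using Cpow_nz.
  - replace m with (Z.of_nat (Z.to_nat m)) by lia. set (n := Z.to_nat m).
    replace (Z.of_nat n + 1)%Z with (Z.of_nat (S n)) by lia.
    now rewrite !Cpowz_of_nat, Cpow_S.
Qed.

Lemma Cpowz_add (z : C) (a b : Z) : z <> 0 -> Cpowz z (a + b) = Cpowz z a * Cpowz z b.
Proof.
  intros Hz. induction b as [|b IH|b IH] using Z.peano_ind.
  - rewrite Z.add_0_r. simpl; ring.
  - replace (a + Z.succ b)%Z with (a + b + 1)%Z by lia.
    unfold Z.succ. rewrite !Cpowz_succ, IH by trivial. ring.
  - pose proof (Cpowz_succ z (a + Z.pred b) Hz) as E1.
    pose proof (Cpowz_succ z (Z.pred b) Hz) as E2.
    replace (a + Z.pred b + 1)%Z with (a + b)%Z in E1 by lia.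
    replace (Z.pred b + 1)%Z with b in E2 by lia.
    rewrite IH, E2 in E1.
    replace (Cpowz z (a + Z.pred b)) with (/ z * (z * Cpowz z (a + Z.pred b)))
      by (field; trivial).
    rewrite <- E1. field; trivial.
Qed.

Lemma Cpowz_nz (z : C) (m : Z) : z <> 0 -> Cpowz z m <> 0.
Proof.
  intros Hz E. pose proof (Cpowz_add z m (- m) Hz) as H.
  rewrite E, Z.add_opp_diag_r in H. simpl in H.
  apply C1_nz. rewrite H; ring.
Qed.

Lemma Cpowz_pow (z : C) (n : nat) (m : Z) :
  z <> 0 -> Cpowz (z ^ n) m = Cpowz z (Z.of_nat n * m).
Proof.
  intros Hz. pose proof (Cpow_nz z n Hz) as Hn.
  induction m as [|m IH|m IH] using Z.peano_ind.
  - now rewrite Z.mul_0_r.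
  - unfold Z.succ. rewrite Cpowz_succ, IH by trivial.
    replace (Z.of_nat n * (m + 1))%Z with (Z.of_nat n * m + Z.of_nat n)%Z by lia.
    rewrite Cpowz_add, Cpowz_of_nat by trivial. ring.
  - pose proof (Cpowz_succ (z ^ n) (Z.pred m) Hn) as E.
    replace (Z.pred m + 1)%Z with m in E by lia. rewrite IH in E.
    replace (Cpowz (z ^ n) (Z.pred m)) with (/ z ^ n * (z ^ n * Cpowz (z ^ n) (Z.pred m)))
      by (field; trivial).
    rewrite <- E.
    replace (Z.of_nat n * m)%Z with (Z.of_nat n * Z.pred m + Z.of_nat n)%Z by lia.
    rewrite Cpowz_add, Cpowz_of_nat by trivial. field; trivial.
Qed.

Lemma Cmod_Cpowz (z : C) (m : Z) : Cmod z = 1%R -> Cmod (Cpowz z m) = 1%R.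
Proof.
  intros Hz. assert (Hz0 : z <> 0) by (apply Cmod_gt_0; lra).
  destruct m as [|p|p]; simpl Cpowz.
  - apply Cmod_1.
  - now rewrite Cmod_pow, Hz, pow1.
  - rewrite Cmod_inv by now apply Cpow_nz. rewrite Cmod_pow, Hz, pow1. field.
Qed.

Lemma Cmod_minus1 : Cmod (-1) = 1%R.
Proof. rewrite Cmod_R. apply Rabs_m1. Qed.

Lemma Cminus1_nz : RtoC (-1) <> 0.
Proof. apply Cmod_gt_0. rewrite Cmod_minus1; lra. Qed.

(** Writing an index as [m + 2 * k] reduces the sign of a term in a residue class to that of [m]. *)
Lemma Cpowz_minus1_even (a k : Z) : Cpowz (-1) (a + 2 * k) = Cpowz (-1) a.
Proof.
  rewrite Cpowz_add by exact Cminus1_nz.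
  rewrite <- (Cpowz_pow (-1) 2) by exact Cminus1_nz.
  replace ((-1) ^ 2) with (RtoC 1) by (simpl; ring).
  assert (E : Cpowz 1 k = 1).
  { destruct k as [|p|p]; simpl Cpowz; rewrite ?Cpow_1_l; trivial. field. }
  rewrite E; ring.
Qed.

Lemma Cpowz_minus1_odd (a k : Z) : Cpowz (-1) (a + 2 * k + 1) = - Cpowz (-1) a.
Proof.
  rewrite Cpowz_succ, Cpowz_minus1_even by exact Cminus1_nz. ring.
Qed.

(** * Bounds and convergence of q-products *)

Lemma exp_mono (x y : R) : (x <= y)%R -> (exp x <= exp y)%R.
Proof. intros [H | ->]; [left; now apply exp_increasing | apply Rle_refl]. Qed.

(** Invert [1/(1 - y) = 1 + y/(1 - y) <= exp(y/(1 - y))]. *)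
Lemma exp_opp_le (y : R) : (y < 1)%R -> (exp (- (y / (1 - y))) <= 1 - y)%R.
Proof.
  intros Hy. rewrite exp_Ropp. rewrite <- (Rinv_inv (1 - y)) at 2.
  apply Rinv_le_contravar; [apply Rinv_0_lt_compat; lra|].
  apply Rle_trans with (1 + y / (1 - y))%R; [right; field; lra | apply exp_ineq1_le].
Qed.

Section QProducts.
Variable q : C.
Hypothesis Hq : (Cmod q < 1)%R.
Let r := Cmod q.

Local Lemma r_bounds : (0 <= r < 1)%R.
Proof. split; [apply Cmod_ge_0 | exact Hq]. Qed.

(** Each factor is at most [1 + |A| r^n <= exp(|A| r^n)], and the exponents form a geometric
    series. *)
Lemma qpoch_n_le (A : C) (n : nat) : (Cmod (qpoch_n A q n) <= exp (Cmod A / (1 - r)))%R.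
Proof.
  pose proof r_bounds as Hr. pose proof (Cmod_ge_0 A) as HA.
  assert (H : (Cmod (qpoch_n A q n) <= exp (Cmod A * ((1 - r ^ n) / (1 - r))))%R).
  { induction n as [|n IH].
    - simpl. rewrite Cmod_1. replace (Cmod A * ((1 - 1) / (1 - r)))%R with 0%R by (field; lra).
      rewrite exp_0; lra.
    - simpl qpoch_n. rewrite Cmod_mult.
      replace (Cmod A * ((1 - r ^ S n) / (1 - r)))%R
        with (Cmod A * ((1 - r ^ n) / (1 - r)) + Cmod A * r ^ n)%R by (simpl; field; lra).
      rewrite exp_plus. apply Rmult_le_compat; auto using Cmod_ge_0.
      eapply Rle_trans; [|apply exp_ineq1_le].
      replace (1 - A * q ^ n) with (1 + - (A * q ^ n)) by ring.
      eapply Rle_trans; [apply Cmod_triangle|].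
      rewrite Cmod_1, Cmod_opp, Cmod_mult, Cmod_pow. apply Rle_refl. }
  eapply Rle_trans; [exact H|]. apply exp_mono.
  apply Rmult_le_compat_l; trivial.
  unfold Rdiv. rewrite <- (Rmult_1_l (/ (1 - r))) at 2.
  apply Rmult_le_compat_r.
  - apply Rlt_le, Rinv_0_lt_compat; lra.
  - pose proof (pow_le r n (proj1 Hr)); lra.
Qed.

(** Each factor is at least [1 - y] with [y = |A| r^n <= |A|], hence at least [exp(-y/(1 - |A|))];
    the exponents again sum geometrically. A bound uniform in [n] keeps the limit away from zero. *)
Lemma qpoch_n_ge (A : C) :
  (Cmod A < 1)%R -> exists c, (0 < c)%R /\ forall n, (c <= Cmod (qpoch_n A q n))%R.
Proof.
  intros HA. pose proof r_bounds as Hr. pose proof (Cmod_ge_0 A) as HA0.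
  set (k := (Cmod A / (1 - Cmod A))%R).
  assert (Hk : (0 <= k)%R).
  { apply Rmult_le_pos; trivial. apply Rlt_le, Rinv_0_lt_compat; lra. }
  exists (exp (- (k * (1 / (1 - r)))))%R. split; [apply exp_pos|]. intros n.
  assert (H : (exp (- (k * ((1 - r ^ n) / (1 - r)))) <= Cmod (qpoch_n A q n))%R).
  { induction n as [|n IH].
    - simpl. rewrite Cmod_1. replace (- (k * ((1 - 1) / (1 - r))))%R with 0%R by (field; lra).
      rewrite exp_0; lra.
    - simpl qpoch_n. rewrite Cmod_mult.
      replace (- (k * ((1 - r ^ S n) / (1 - r))))%R
        with (- (k * ((1 - r ^ n) / (1 - r))) + - (k * r ^ n))%R by (simpl; field; lra).
      rewrite exp_plus. apply Rmult_le_compat; auto using Rlt_le, exp_pos.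
      set (y := (Cmod A * r ^ n)%R).
      assert (Hrn : (0 <= r ^ n <= 1)%R).
      { split; [apply pow_le; lra|]. rewrite <- (pow1 n). apply pow_incr; lra. }
      assert (Hy : (0 <= y <= Cmod A)%R) by (unfold y; nra).
      apply Rle_trans with (1 - y)%R.
      + eapply Rle_trans; [|apply exp_opp_le; lra]. apply exp_mono, Ropp_le_contravar.
        unfold k. replace (Cmod A / (1 - Cmod A) * r ^ n)%R with (y / (1 - Cmod A))%R
          by (unfold y; field; lra).
        apply Rmult_le_compat_l; [lra|]. apply Rinv_le_contravar; lra.
      + assert (T := Cmod_triangle (1 - A * q ^ n) (A * q ^ n)).
        replace (1 - A * q ^ n + A * q ^ n) with (RtoC 1) in T by ring.
        rewrite Cmod_1, (Cmod_mult A), Cmod_pow in T. fold r y in T. lra. }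
  eapply Rle_trans; [|exact H]. apply exp_mono, Ropp_le_contravar.
  apply Rmult_le_compat_l; trivial. unfold Rdiv.
  apply Rmult_le_compat_r; [apply Rlt_le, Rinv_0_lt_compat; lra|].
  pose proof (pow_le r n (proj1 Hr)); lra.
Qed.

(** Consecutive partial products differ by a bounded factor times [q^n], so the telescoping series
    of differences converges. *)
Lemma qpoch_Clim (A : C) : Clim (qpoch_n A q) (qpoch A q).
Proof.
  pose proof r_bounds as Hr.
  set (a := fun k => qpoch_n A q (S k) - qpoch_n A q k).
  assert (H : Clim (qpoch_n A q) (CSeries a + 1)).
  { apply Clim_ext with (fun n => psum a n + 1).
    - intros n. unfold a. rewrite psum_telescope. simpl; ring.
    - apply Clim_plus; [|apply Clim_const].
      apply psum_geom_Clim with (exp (Cmod A / (1 - r)) * Cmod A)%R r; trivial.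
      intros n. unfold a. simpl qpoch_n.
      replace (qpoch_n A q n * (1 - A * q ^ n) - qpoch_n A q n)
        with (- (qpoch_n A q n * A * q ^ n)) by ring.
      rewrite Cmod_opp, !Cmod_mult, Cmod_pow. fold r.
      apply Rmult_le_compat_r; [apply pow_le; lra|].
      apply Rmult_le_compat_r; [apply Cmod_ge_0 | apply qpoch_n_le]. }
  unfold qpoch. now rewrite (CLim_seq_eq _ _ H).
Qed.

Lemma qpoch_nz (A : C) : (Cmod A < 1)%R -> qpoch A q <> 0.
Proof.
  intros HA E. destruct (qpoch_n_ge A HA) as (c & Hc & H).
  pose proof (qpoch_Clim A) as L. rewrite E in L. unfold Clim in L.
  assert (Hle : Rbar_le c 0).
  { apply is_lim_seq_le with (fun _ => c) (fun n => Cmod (qpoch_n A q n - 0)).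
    - intros n. replace (qpoch_n A q n - 0) with (qpoch_n A q n) by ring. apply H.
    - apply is_lim_seq_const.
    - exact L. }
  simpl in Hle; lra.
Qed.

Lemma qpoch_n_rec (A : C) (n : nat) :
  qpoch_n A q (S n) = (1 - A) * qpoch_n (A * q) q n.
Proof.
  induction n as [|n IH]; [simpl; ring|].
  change (qpoch_n A q (S (S n))) with (qpoch_n A q (S n) * (1 - A * q ^ S n)).
  rewrite IH. simpl; ring.
Qed.

Lemma qpoch_rec (A : C) : qpoch A q = (1 - A) * qpoch (A * q) q.
Proof.
  apply Clim_unique with (fun n => qpoch_n A q (S n)).
  - apply Clim_subseq; [intros; lia | apply qpoch_Clim].
  - eapply Clim_ext; [intros n; symmetry; apply qpoch_n_rec|].
    apply Clim_mult; [apply Clim_const | apply qpoch_Clim].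
Qed.

Lemma qpoch_n_split5 (n : nat) :
  qpoch_n q q (5 * n) = qpoch_n q (q ^ 5) n * qpoch_n (q ^ 2) (q ^ 5) n
    * qpoch_n (q ^ 3) (q ^ 5) n * qpoch_n (q ^ 4) (q ^ 5) n * qpoch_n (q ^ 5) (q ^ 5) n.
Proof.
  induction n as [|n IH]; [simpl; ring|].
  replace (5 * S n)%nat with (S (S (S (S (S (5 * n)))))) by lia.
  cbn [qpoch_n]. rewrite IH. rewrite !Cpow_S, Cpow_mult_r, !Cpow_S. ring.
Qed.

End QProducts.

Lemma Cmod_pow_lt_1 (q : C) (n : nat) : (Cmod q < 1)%R -> (Cmod (q ^ S n) < 1)%R.
Proof.
  intros Hq. rewrite Cmod_pow. apply pow_lt_1_compat; [|lia]. split; trivial. apply Cmod_ge_0.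
Qed.

Lemma qpoch_split5 (q : C) : (Cmod q < 1)%R ->
  qpoch q q = qpoch q (q ^ 5) * qpoch (q ^ 2) (q ^ 5)
    * qpoch (q ^ 3) (q ^ 5) * qpoch (q ^ 4) (q ^ 5) * qpoch (q ^ 5) (q ^ 5).
Proof.
  intros Hq. pose proof (Cmod_pow_lt_1 q 4 Hq) as Hq5.
  apply Clim_unique with (fun n => qpoch_n q q (5 * n)).
  - apply Clim_subseq; [intros; lia | now apply qpoch_Clim].
  - eapply Clim_ext; [intros n; symmetry; apply qpoch_n_split5|].
    repeat apply Clim_mult; now apply qpoch_Clim.
Qed.

(** * The Jacobi triple product *)

Section TripleProduct.
Variables q z w : C.
Hypothesis Hq : in_punctured_disc q.
Hypothesis Hzw : z * w = 1.

Local Lemma q_nz : q <> 0.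
Proof. apply Cmod_gt_0, Hq. Qed.

(* [1 / (q; q)_k], whose natural value at negative [k] is [0]: this keeps [rqfact_pred] true
   for all [k] and makes the finite triple product a sum with finite support. *)
Definition rqfact (k : Z) : C :=
  if (k <? 0)%Z then 0 else / qpoch_n q q (Z.to_nat k).

Lemma qfact_nz (n : nat) : qpoch_n q q n <> 0.
Proof.
  destruct (qpoch_n_ge q (proj2 Hq) q (proj2 Hq)) as (c & Hc & H).
  apply Cmod_gt_0. specialize (H n); lra.
Qed.

Lemma rqfact_of_nat (n : nat) : rqfact (Z.of_nat n) = / qpoch_n q q n.
Proof.
  unfold rqfact. rewrite Nat2Z.id. now destruct (Z.ltb_spec (Z.of_nat n) 0); [lia|].
Qed.

Lemma rqfact_neg (k : Z) : (k < 0)%Z -> rqfact k = 0.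
Proof. intros H. unfold rqfact. now apply Z.ltb_lt in H as ->. Qed.

Lemma rqfact_pred (k : Z) : rqfact (k - 1) = (1 - Cpowz q k) * rqfact k.
Proof.
  destruct (Z_lt_le_dec k 1) as [Hk|Hk].
  - rewrite (rqfact_neg (k - 1)) by lia.
    destruct (Z.eq_dec k 0) as [->|Hk0]; [simpl; ring|].
    rewrite rqfact_neg by lia. ring.
  - replace k with (Z.of_nat (S (Z.to_nat (k - 1)))) by lia.
    set (n := Z.to_nat (k - 1)).
    replace (Z.of_nat (S n) - 1)%Z with (Z.of_nat n) by lia.
    rewrite !rqfact_of_nat, Cpowz_of_nat.
    pose proof (qfact_nz (S n)) as H. simpl qpoch_n in *. rewrite Cpow_S.
    pose proof (qfact_nz n). field. split; trivial.
    intros E. apply H. rewrite E; ring.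
Qed.

(** The Gaussian binomial coefficient [[2n choose n + j]], extended by zero to all integers [j]. *)
Definition jtp_coef (n : nat) (j : Z) : C :=
  qpoch_n q q (2 * n) * rqfact (Z.of_nat n - j) * rqfact (Z.of_nat n + j).

Lemma jtp_coef_out (n : nat) (j : Z) : (Z.of_nat n < Z.abs j)%Z -> jtp_coef n j = 0.
Proof.
  intros H. unfold jtp_coef. destruct (Z_lt_le_dec j 0).
  - rewrite (rqfact_neg (Z.of_nat n + j)) by lia. ring.
  - rewrite (rqfact_neg (Z.of_nat n - j)) by lia. ring.
Qed.

(** Two q-Pascal steps combined. All reciprocal factorials reduce to those at [a] and [b], leaving a
    rational identity in [q^a] and [q^b]. *)
Lemma jtp_coef_succ (n : nat) (j : Z) :
  jtp_coef (S n) j = (1 + q ^ (2 * n + 1)) * jtp_coef n j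
    + Cpowz q (Z.of_nat n + 1 - j) * jtp_coef n (j - 1)
    + Cpowz q (Z.of_nat n + 1 + j) * jtp_coef n (j + 1).
Proof.
  pose proof q_nz as Hq0. unfold jtp_coef.
  set (a := (Z.of_nat n + 1 - j)%Z). set (b := (Z.of_nat n + 1 + j)%Z).
  replace (Z.of_nat (S n) - j)%Z with a by lia.
  replace (Z.of_nat (S n) + j)%Z with b by lia.
  replace (Z.of_nat n - j)%Z with (a - 1)%Z by lia.
  replace (Z.of_nat n + j)%Z with (b - 1)%Z by lia.
  replace (Z.of_nat n - (j - 1))%Z with a by lia.
  replace (Z.of_nat n + (j - 1))%Z with (b - 1 - 1)%Z by lia.
  replace (Z.of_nat n - (j + 1))%Z with (a - 1 - 1)%Z by lia.
  replace (Z.of_nat n + (j + 1))%Z with b by lia.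
  rewrite !rqfact_pred.
  assert (E : forall k, Cpowz q (k - 1) = Cpowz q k / q).
  { intros k. replace k with (k - 1 + 1)%Z at 2 by lia. rewrite Cpowz_succ by trivial.
    field; trivial. }
  rewrite !E.
  (* Because [a + b = 2n + 2], this eliminates the last power that depends on [n]. *)
  assert (EXY : q ^ (2 * n) = Cpowz q a * Cpowz q b / (q * q)).
  { rewrite <- Cpowz_add, <- Cpowz_of_nat by trivial.
    replace (a + b)%Z with (Z.of_nat (2 * n) + 1 + 1)%Z by lia.
    rewrite !Cpowz_succ by trivial. field; trivial. }
  replace (2 * S n)%nat with (S (S (2 * n))) by lia.
  replace (2 * n + 1)%nat with (S (2 * n)) by lia.
  cbn [qpoch_n]. rewrite !Cpow_S, EXY. field; trivial.
Qed.

(** The two hypotheses determine [t j = (-z)^j q^(j(j+1)/2)]; giving it by its recurrence lets each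
    application keep its own closed form of the exponent. *)
Variable t : Z -> C.
Hypothesis t_0 : t 0%Z = 1.
Hypothesis t_succ : forall j, t (j + 1)%Z = - z * Cpowz q (j + 1) * t j.

(** Induction on [n]: since [z w = 1], the new factors multiply to [(1 - z q^(n+1))(1 - w q^n) = 1 +
    q^(2n+1) - z q^(n+1) - w q^n], matching the three terms of [jtp_coef_succ]. The window of [S n]
    pairs contains the whole support [|j| <= n]. *)
Lemma jtp_finite (n : nat) :
  zpsum (fun j => t j * jtp_coef n j) (S n) = qpoch_n (z * q) q n * qpoch_n w q n.
Proof.
  pose proof q_nz as Hq0.
  induction n as [|n IH].
  - unfold zpsum; simpl. unfold zpair. simpl Z.of_nat. rewrite t_0.
    rewrite (jtp_coef_out 0 (- _)) by (simpl; lia).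
    unfold jtp_coef. simpl. unfold rqfact. simpl. field.
  - set (f := fun j => t j * jtp_coef n j) in IH.
    assert (Hf : forall j, (Z.of_nat n < Z.abs j)%Z -> f j = 0).
    { intros j Hj. unfold f. rewrite jtp_coef_out by trivial. ring. }
    assert (E : forall N, zpsum (fun j => t j * jtp_coef (S n) j) N
      = zpsum (fun j => (1 + q ^ (2 * n + 1)) * f j + (- z * q ^ (n + 1)) * f (j - 1)%Z
                        + (- w * q ^ n) * f (j + 1)%Z) N).
    { intros N. apply psum_ext. intros k.
      assert (E : forall j, t j * jtp_coef (S n) j
        = (1 + q ^ (2 * n + 1)) * f j + (- z * q ^ (n + 1)) * f (j - 1)%Z
                        + (- w * q ^ n) * f (j + 1)%Z).
      { intros j. rewrite jtp_coef_succ. unfold f. rewrite t_succ.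
        pose proof (t_succ (j - 1)) as E. rewrite Z.sub_add in E.
        replace (t j * ((1 + q ^ (2 * n + 1)) * jtp_coef n j
          + Cpowz q (Z.of_nat n + 1 - j) * jtp_coef n (j - 1)
          + Cpowz q (Z.of_nat n + 1 + j) * jtp_coef n (j + 1)))
        with ((1 + q ^ (2 * n + 1)) * (t j * jtp_coef n j)
          + Cpowz q (Z.of_nat n + 1 - j) * t j * jtp_coef n (j - 1)
          + 1 * Cpowz q (Z.of_nat n + 1 + j) * t j * jtp_coef n (j + 1)) by ring.
        rewrite <- Hzw. rewrite E at 2.
        replace (Z.of_nat n + 1 + j)%Z with (Z.of_nat n + (j + 1))%Z by lia.
        rewrite (Cpowz_add q (Z.of_nat n)), Cpowz_of_nat by trivial.
        replace (n + 1)%nat with (S n) by lia.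
        rewrite <- (Cpowz_of_nat q (S n)).
        replace (Z.of_nat (S n)) with (Z.of_nat n + 1 - j + j)%Z at 1 by lia.
        rewrite (Cpowz_add q (Z.of_nat n + 1 - j)) by trivial.
        ring. }
      unfold zpair. now rewrite !E. }
    (* The shifts only produce boundary terms, all at indices outside the support of [f]. *)
    rewrite E, zpsum_lin, zpsum_pred, zpsum_succ.
    rewrite !Hf by lia.
    unfold zpsum in *. cbn [psum]. cbn [psum] in IH. rewrite IH.
    unfold zpair at 1 2 3. rewrite !Hf by lia.
    cbn [qpoch_n].
    replace (2 * n + 1)%nat with (S (n + n)) by lia.
    replace (n + 1)%nat with (S n) by lia.
    rewrite !Cpow_S, Cpow_add_r.
    replace (1 + q * (q ^ n * q ^ n)) with (1 + z * w * q * q ^ n * q ^ n) by (rewrite Hzw; ring).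
    ring.
Qed.

Lemma jtp_coef_bounded : exists M, forall n j, (Cmod (jtp_coef n j) <= M)%R.
Proof.
  destruct (qpoch_n_ge q (proj2 Hq) q (proj2 Hq)) as (c & Hc & H).
  assert (Hr : forall k, (Cmod (rqfact k) <= / c)%R).
  { intros k. unfold rqfact. destruct (k <? 0)%Z.
    - rewrite Cmod_0. now apply Rlt_le, Rinv_0_lt_compat.
    - rewrite Cmod_inv by apply qfact_nz. now apply Rinv_le_contravar. }
  eexists. intros n j. unfold jtp_coef. rewrite !Cmod_mult.
  apply Rmult_le_compat; auto using Cmod_ge_0, Rmult_le_pos.
  apply Rmult_le_compat; auto using Cmod_ge_0.
  apply qpoch_n_le, Hq.
Qed.

Lemma rqfact_Clim (j : Z) : Clim (fun n => rqfact (Z.of_nat n + j)) (/ qpoch q q).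
Proof.
  (* Dropping the first [|j|] terms makes the argument [n + |j| + j] a natural number. *)
  apply Clim_decr_n with (Z.abs_nat j).
  apply Clim_ext with (fun n => / qpoch_n q q (n + Z.to_nat (Z.abs j + j))).
  - intros n. rewrite <- rqfact_of_nat. f_equal. lia.
  - apply Clim_subseq with (u := fun n => / qpoch_n q q n); [intros; lia|].
    destruct (qpoch_n_ge q (proj2 Hq) q (proj2 Hq)) as (c & Hc & H).
    apply Clim_inv with c; trivial.
    + apply qpoch_nz; apply Hq.
    + apply qpoch_Clim, Hq.
Qed.

Lemma jtp_coef_Clim (j : Z) : Clim (fun n => jtp_coef n j) (/ qpoch q q).
Proof.
  assert (Hnz : qpoch q q <> 0) by (apply qpoch_nz; apply Hq).
  replace (/ qpoch q q) with (qpoch q q * / qpoch q q * / qpoch q q) by (field; trivial).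
  unfold jtp_coef. repeat apply Clim_mult.
  - apply Clim_subseq with (u := qpoch_n q q); [intros; lia|]. apply qpoch_Clim, Hq.
  - apply rqfact_Clim.
  - apply rqfact_Clim.
Qed.

(** Letting [n] grow in the finite form, every coefficient tends to [1/(q; q)_oo] while staying
    bounded, so dominated convergence applies with [t] as majorant. *)
Theorem jacobi_triple_product :
  geom_bounded (Cmod q) t -> Zsum t = qpoch q q * qpoch (z * q) q * qpoch w q.
Proof.
  intros Ht. assert (Hnz : qpoch q q <> 0) by (apply qpoch_nz; apply Hq).
  assert (E : / qpoch q q * Zsum t = qpoch (z * q) q * qpoch w q).
  { destruct jtp_coef_bounded as [M HM].
    eapply Clim_unique.
    - apply zpsum_dominated_Clim with (r := Cmod q) (c := jtp_coef) (M := M); trivial.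
      + split; [apply Cmod_ge_0 | apply Hq].
      + apply jtp_coef_Clim.
    - eapply Clim_ext; [intros n; symmetry; apply jtp_finite|].
      apply Clim_mult; apply qpoch_Clim, Hq. }
  rewrite <- Cmult_assoc, <- E. field; trivial.
Qed.

End TripleProduct.

(** * The 5-dissection of Euler's product *)

(** The exponents are halved quadratics. Parity of [m(m + 1)], stated as a formula for [m * m],
    makes their exact halving a matter of linear arithmetic in [quad_lia]. *)
Lemma pronic_even (m : Z) : exists k, (m * m = 2 * k - m)%Z.
Proof.
  destruct (Z.Even_or_Odd m) as [[k ->] | [k ->]].
  - exists (k * (2 * k + 1))%Z. ring.
  - exists ((2 * k + 1) * (k + 1))%Z. ring.
Qed.

Ltac quad_lia m :=
  let k := fresh "k" in let Hk := fresh "Hk" in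
  destruct (pronic_even m) as [k Hk];
  rewrite ?Z.pow_2_r; Z.to_euclidean_division_equations; lia.

Lemma geom_bounded_Cpowz (q : C) (k : nat) (e : Z -> Z) (c : Z) :
  in_punctured_disc q -> (forall m, Z.of_nat k * Z.abs m <= e m + c)%Z ->
  geom_bounded (Cmod (q ^ k)) (fun m => Cpowz q (e m)).
Proof.
  intros [Hq0 Hq1] He.
  assert (Hq : q <> 0) by now apply Cmod_gt_0.
  (* From [e m >= k|m| - c] one gets [|q|^(e m) <= |q|^(-c) |q^k|^|m|]. *)
  exists (/ Cmod (Cpowz q c))%R; intros m.
  pose proof (proj1 (Cmod_gt_0 _) (Cpowz_nz q c Hq)) as Hc.
  apply Rmult_le_reg_l with (Cmod (Cpowz q c)); trivial.
  rewrite <- Rmult_assoc, Rinv_r, Rmult_1_l by lra.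
  rewrite <- Cmod_mult, <- Cpowz_add by trivial.
  specialize (He m).
  replace (c + e m)%Z with (Z.of_nat (Z.to_nat (c + e m))) by lia.
  rewrite Cpowz_of_nat, !Cmod_pow, <- pow_mult.
  apply pow_antitone; [lra | lia].
Qed.

Lemma Zsum_theta (q z w : C) (e : Z -> Z) (c : Z) :
  in_punctured_disc q -> z * w = 1 ->
  e 0%Z = 0%Z -> (forall m, 5 * Z.abs m <= e m + c)%Z ->
  (forall m, Cpowz q (e (m + 1)%Z) = z * Cpowz q (5 * (m + 1)) * Cpowz q (e m)) ->
  Zsum (fun m => Cpowz (-1) m * Cpowz q (e m))
  = qpoch (q ^ 5) (q ^ 5) * qpoch (z * q ^ 5) (q ^ 5) * qpoch w (q ^ 5).
Proof.
  intros Hq Hzw H0 Hc Hs.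
  assert (Hq0 : q <> 0) by (apply Cmod_gt_0, Hq).
  assert (Hq5 : in_punctured_disc (q ^ 5)).
  { split; [now apply Cmod_gt_0, Cpow_nz | apply Cmod_pow_lt_1, Hq]. }
  apply jacobi_triple_product; trivial.
  - rewrite H0. simpl; ring.
  - intros j. rewrite Hs, Cpowz_succ, Cpowz_pow by (trivial; exact Cminus1_nz).
    simpl (Z.of_nat 5). ring.
  - apply geom_bounded_mult with 1%R; [apply Cmod_ge_0| |].
    + intros m. rewrite Cmod_Cpowz by exact Cmod_minus1. lra.
    + now apply geom_bounded_Cpowz with c.
Qed.

Definition theta1 (q : C) : C :=
  Zsum (fun m => Cpowz (-1) m * Cpowz q ((5 * (m * m) + m) / 2)).
Definition theta2 (q : C) : C :=
  Zsum (fun m => Cpowz (-1) m * Cpowz q ((5 * (m * m) + 3 * m) / 2)).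

Lemma abs_square_le (c m : Z) : (2 * c * Z.abs m <= m * m + c * c)%Z.
Proof. rewrite <- (Z.abs_square m). pose proof (Z.square_nonneg (Z.abs m - c)). lia. Qed.

(** One bound for all exponents with leading term [5m^2/2]: after doubling, the theta series need at
    most [13|m|] and the Lambert series at most [9|m|]. *)
Lemma abs_quad_le (m : Z) : (14 * Z.abs m <= 5 * (m * m) + 20)%Z.
Proof. nia. Qed.

Lemma qpoch_pow5_nz (q : C) (k : nat) : in_punctured_disc q -> qpoch (q ^ S k) (q ^ 5) <> 0.
Proof. intros [_ Hq]. now apply qpoch_nz; apply Cmod_pow_lt_1. Qed.

Lemma rr_nz (q : C) : in_punctured_disc q -> rrG q <> 0 /\ rrH q <> 0.
Proof.
  intros Hq.
  assert (Hdiv : forall x y : C, x <> 0 -> y <> 0 -> 1 / (x * y) <> 0).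
  { intros x y Hx Hy E. apply C1_nz.
    replace (RtoC 1) with (1 / (x * y) * (x * y)) by (field; auto). rewrite E; ring. }
  split; apply Hdiv; try now apply qpoch_pow5_nz.
  rewrite <- (Cpow_1_r q) at 1. now apply qpoch_pow5_nz.
Qed.

(** The triple product in base [q^5] at [z = q^(-2)] yields the residue classes 0, 2 and 3 of
    [(q; q)_oo]; [rrG] cancels the missing classes 1 and 4. For [theta2] the choice is
    [z = q^(-1)]. *)
Lemma theta1_rrG (q : C) : in_punctured_disc q -> theta1 q = qpoch q q * rrG q.
Proof.
  intros Hq. assert (Hq0 : q <> 0) by (apply Cmod_gt_0, Hq).
  unfold theta1.
  rewrite (Zsum_theta q (/ q ^ 2) (q ^ 2) _ 20 Hq).
  - rewrite (qpoch_split5 q) by apply Hq. unfold rrG.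
    replace (/ q ^ 2 * q ^ 5) with (q ^ 3) by (field; trivial).
    pose proof (qpoch_pow5_nz q 0 Hq) as H1. pose proof (qpoch_pow5_nz q 3 Hq).
    rewrite Cpow_1_r in H1. field. auto.
  - field; trivial.
  - reflexivity.
  - intros m. pose proof (abs_quad_le m). quad_lia m.
  - intros m.
    replace ((5 * ((m + 1) * (m + 1)) + (m + 1)) / 2)%Z
      with (- Z.of_nat 2 + (5 * (m + 1) + (5 * (m * m) + m) / 2))%Z by quad_lia m.
    rewrite !(Cpowz_add q), Cpowz_opp_nat by trivial. ring.
Qed.

Lemma theta2_rrH (q : C) : in_punctured_disc q -> theta2 q = qpoch q q * rrH q.
Proof.
  intros Hq. assert (Hq0 : q <> 0) by (apply Cmod_gt_0, Hq).
  unfold theta2.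
  rewrite (Zsum_theta q (/ q ^ 1) (q ^ 1) _ 20 Hq).
  - rewrite (qpoch_split5 q) by apply Hq. unfold rrH.
    replace (/ q ^ 1 * q ^ 5) with (q ^ 4) by (field; trivial).
    pose proof (qpoch_pow5_nz q 1 Hq). pose proof (qpoch_pow5_nz q 2 Hq).
    rewrite Cpow_1_r. field. auto.
  - field; trivial.
  - reflexivity.
  - intros m. pose proof (abs_quad_le m). quad_lia m.
  - intros m.
    replace ((5 * ((m + 1) * (m + 1)) + 3 * (m + 1)) / 2)%Z
      with (- Z.of_nat 1 + (5 * (m + 1) + (5 * (m * m) + 3 * m) / 2))%Z by quad_lia m.
    rewrite !(Cpowz_add q), Cpowz_opp_nat by trivial. ring.
Qed.

(** The hypotheses make [z] a primitive fifth root of unity with [a = z + 1/z], and [a - z] is its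
    inverse. The five residue classes of the triple product add up to
    [(1 - z^4) theta1 - (z - z^3) q theta2], from which [1 - 1/z] is cancelled. *)
Lemma theta_fifth_root (q z a : C) :
  in_punctured_disc q -> Cmod z = 1%R -> a * a + a = 1 -> z * z - a * z + 1 = 0 ->
  theta1 (q ^ 5) - (1 + a) * q * theta2 (q ^ 5)
  = qpoch q q * qpoch (z * q) q * qpoch ((a - z) * q) q.
Proof.
  intros Hq Hz Ha Hza.
  assert (Hq0 : q <> 0) by (apply Cmod_gt_0, Hq).
  assert (Hz0 : z <> 0) by (apply Cmod_gt_0; lra).
  assert (Hr : (0 <= Cmod q < 1)%R) by (split; [apply Cmod_ge_0 | apply Hq]).
  assert (Hq5 : in_punctured_disc (q ^ 5)).
  { split; [now apply Cmod_gt_0, Cpow_nz | apply Cmod_pow_lt_1, Hq]. }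
  set (w := a - z).
  assert (Hzw : z * w = 1).
  { unfold w. replace (z * (a - z)) with (1 - (z * z - a * z + 1)) by ring.
    rewrite Hza; ring. }
  set (t := fun m => Cpowz (-1) m * Cpowz z m * Cpowz q ((m * m + m) / 2)).
  assert (Hunit : forall m, (Cmod (Cpowz (-1) m * Cpowz z m) <= 1)%R).
  { intros m. rewrite Cmod_mult, !Cmod_Cpowz by (trivial; exact Cmod_minus1). lra. }
  assert (Ht : geom_bounded (Cmod q) t).
  { apply geom_bounded_mult with 1%R; trivial; [apply Hr|].
    rewrite <- (Cpow_1_r q) at 1. apply geom_bounded_Cpowz with 2%Z; trivial.
    intros m. assert (2 * Z.abs m <= m * m + m + 4)%Z by nia. quad_lia m. }
  assert (E : Zsum t = qpoch q q * qpoch (z * q) q * qpoch w q).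
  { apply jacobi_triple_product; trivial.
    - unfold t; simpl; ring.
    - intros j. unfold t.
      replace (((j + 1) * (j + 1) + (j + 1)) / 2)%Z
        with ((j + 1) + (j * j + j) / 2)%Z by quad_lia j.
      rewrite (Cpowz_add q), !(Cpowz_succ _ j) by (trivial; exact Cminus1_nz). ring. }
  assert (Hz5 : z ^ 5 = 1).
  { assert (E2 : z * z = a * z - 1).
    { replace (z * z) with ((z * z - a * z + 1) + (a * z - 1)) by ring. rewrite Hza; ring. }
    assert (E3 : a * a = 1 - a).
    { replace (a * a) with ((a * a + a) - a) by ring. now rewrite Ha. }
    (* The power is reduced by hand modulo [z^2 = a z - 1] and [a^2 = 1 - a]. *)
    replace (z ^ 5) with (z * z * (z * z) * z) by ring.
    rewrite E2.
    replace ((a * z - 1) * (a * z - 1) * z)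
      with (a * a * (z * z) * z - 2 * a * (z * z) + z) by ring.
    rewrite E3, E2.
    replace ((1 - a) * (a * z - 1) * z - 2 * a * (a * z - 1) + z)
      with (a * (z * z) - a * a * (z * z) - z + a * z - 2 * (a * a) * z + 2 * a + z) by ring.
    rewrite E3, E2.
    replace (a * (a * z - 1) - (1 - a) * (a * z - 1) - z + a * z - 2 * (1 - a) * z + 2 * a + z)
      with (2 * (a * a) * z + 2 * a * z - 2 * z + 1) by ring.
    rewrite E3. ring. }
  assert (Hth1 : geom_bounded (Cmod ((q ^ 5) ^ 5))
                   (fun m => Cpowz (-1) m * Cpowz (q ^ 5) ((5 * (m * m) + m) / 2))).
  { apply geom_bounded_mult with 1%R; [apply Cmod_ge_0| |].
    - intros m. rewrite Cmod_Cpowz by exact Cmod_minus1. lra.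
    - apply geom_bounded_Cpowz with 20%Z; trivial.
      intros m. pose proof (abs_quad_le m). quad_lia m. }
  assert (Hth2 : geom_bounded (Cmod ((q ^ 5) ^ 5))
                   (fun m => Cpowz (-1) m * Cpowz (q ^ 5) ((5 * (m * m) + 3 * m) / 2))).
  { apply geom_bounded_mult with 1%R; [apply Cmod_ge_0| |].
    - intros m. rewrite Cmod_Cpowz by exact Cmod_minus1. lra.
    - apply geom_bounded_Cpowz with 20%Z; trivial.
      intros m. pose proof (abs_quad_le m). quad_lia m. }
  assert (Hr25 : (0 <= Cmod ((q ^ 5) ^ 5) < 1)%R).
  { split; [apply Cmod_ge_0 | apply Cmod_pow_lt_1, Hq5]. }
  assert (Hz5m : forall m j, Cpowz z (5 * m + j) = Cpowz z j).
  { intros m j. rewrite Cpowz_add by trivial.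
    change 5%Z with (Z.of_nat 5). rewrite <- Cpowz_pow, Hz5 by trivial.
    replace (Cpowz 1 m) with (RtoC 1); [ring|].
    destruct m as [|p|p]; simpl Cpowz; rewrite ?Cpow_1_l; trivial. field. }
  assert (P0 : Zsum (fun m => t (5 * m)%Z) = theta1 (q ^ 5)).
  { apply Zsum_ext; intros m. unfold t.
    rewrite <- (Z.add_0_r (5 * m)) at 2. rewrite Hz5m, Cpowz_pow by trivial.
    replace (5 * m)%Z with (m + 2 * (2 * m))%Z at 1 by lia.
    rewrite Cpowz_minus1_even. simpl (Cpowz z 0). rewrite Cmult_1_r.
    do 2 f_equal. quad_lia m. }
  assert (P1 : Zsum (fun m => t (5 * m + 1)%Z) = - z * q * theta2 (q ^ 5)).
  { unfold theta2. rewrite <- (Zsum_scal (Cmod ((q ^ 5) ^ 5))) by trivial.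
    apply Zsum_ext; intros m. unfold t.
    rewrite Hz5m, Cpowz_pow by trivial.
    replace (5 * m + 1)%Z with (m + 2 * (2 * m) + 1)%Z at 1 by lia.
    rewrite Cpowz_minus1_odd.
    replace (((5 * m + 1) * (5 * m + 1) + (5 * m + 1)) / 2)%Z
      with (Z.of_nat 1 + Z.of_nat 5 * ((5 * (m * m) + 3 * m) / 2))%Z by quad_lia m.
    rewrite (Cpowz_add q), Cpowz_of_nat by trivial. simpl (Cpowz z 1). ring. }
  (* Reflection sends [5m + 2] to [-(5m + 2) - 1]: the triangular exponent is unchanged, the parity
     flips, and [z] contributes the constant [z^2]. *)
  assert (P2 : Zsum (fun m => t (5 * m + 2)%Z) = 0).
  { apply Zsum_antisymmetric with (Cmod q); trivial.
    - apply geom_bounded_comp5; trivial; lia.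
    - intros m. unfold t. rewrite !Hz5m.
      replace (5 * (- 1 - m) + 2)%Z with (5 * m + 2 + 2 * (-5 * m - 3) + 1)%Z at 1 by lia.
      rewrite Cpowz_minus1_odd.
      replace ((5 * (- 1 - m) + 2) * (5 * (- 1 - m) + 2) + (5 * (- 1 - m) + 2))%Z
        with ((5 * m + 2) * (5 * m + 2) + (5 * m + 2))%Z by ring. ring. }
  (* The classes 3 and 4 are reflections of the classes 1 and 0, up to sign and a power of [z]. *)
  assert (P3 : Zsum (fun m => t (5 * m + 3)%Z) = z ^ 3 * q * theta2 (q ^ 5)).
  { unfold theta2. rewrite <- (Zsum_scal (Cmod ((q ^ 5) ^ 5))) by trivial.
    rewrite <- Zsum_reflect.
    apply Zsum_ext; intros m. unfold t.
    rewrite Hz5m, Cpowz_pow by trivial.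
    replace (5 * (- 1 - m) + 3)%Z with (m + 2 * (- 3 * m - 1))%Z at 1 by lia.
    rewrite Cpowz_minus1_even.
    replace (((5 * (- 1 - m) + 3) * (5 * (- 1 - m) + 3) + (5 * (- 1 - m) + 3)) / 2)%Z
      with (Z.of_nat 1 + Z.of_nat 5 * ((5 * (m * m) + 3 * m) / 2))%Z by quad_lia m.
    rewrite (Cpowz_add q), Cpowz_of_nat by trivial.
    change (Cpowz z 3) with (z ^ 3). ring. }
  assert (P4 : Zsum (fun m => t (5 * m + 4)%Z) = - z ^ 4 * theta1 (q ^ 5)).
  { unfold theta1. rewrite <- (Zsum_scal (Cmod ((q ^ 5) ^ 5))) by trivial.
    rewrite <- Zsum_reflect.
    apply Zsum_ext; intros m. unfold t.
    rewrite Hz5m, Cpowz_pow by trivial.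
    replace (5 * (- 1 - m) + 4)%Z with (m + 2 * (- 3 * m - 1) + 1)%Z at 1 by lia.
    rewrite Cpowz_minus1_odd.
    replace (((5 * (- 1 - m) + 4) * (5 * (- 1 - m) + 4) + (5 * (- 1 - m) + 4)) / 2)%Z
      with (Z.of_nat 5 * ((5 * (m * m) + m) / 2))%Z by quad_lia m.
    change (Cpowz z 4) with (z ^ 4). ring. }
  rewrite (Zsum_split5 (Cmod q)), P0, P1, P2, P3, P4 in E by trivial.
  rewrite (qpoch_rec q (proj2 Hq) w) in E.
  assert (Hz4 : z ^ 4 = w).
  { replace (z ^ 4) with (z ^ 5 * w); [rewrite Hz5; ring|].
    replace (z ^ 5 * w) with (z ^ 4 * (z * w)) by ring. rewrite Hzw; ring. }
  assert (Hz3 : z ^ 3 = w * w).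
  { replace (z ^ 3) with (z ^ 4 * w); [rewrite Hz4; ring|].
    replace (z ^ 4 * w) with (z ^ 3 * (z * w)) by ring. rewrite Hzw; ring. }
  (* If [w = 1] then [z = 1] and [a = 2], which contradicts [a^2 + a = 1]. *)
  assert (Hw1 : 1 - w <> 0).
  { intros Hw. assert (Ew : w = 1) by (replace w with (1 - (1 - w)) by ring; rewrite Hw; ring).
    assert (Ez : z = 1) by (rewrite <- Hzw, Ew; ring).
    assert (Ea : a = 2) by (replace a with (z + w) by (unfold w; ring); rewrite Ez, Ew; ring).
    rewrite Ea in Ha. apply (f_equal Re) in Ha. simpl in Ha. lra. }
  (* The coefficient of [theta2] rests on [(1 - w)(1 + z + w) = z - w^2], valid because
     [z w = 1]. *)
  assert (E' : (1 - w) * (theta1 (q ^ 5) - (1 + a) * q * theta2 (q ^ 5))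
               = (1 - w) * (qpoch q q * qpoch (z * q) q * qpoch (w * q) q)).
  { replace ((1 - w) * (qpoch q q * qpoch (z * q) q * qpoch (w * q) q))
      with (qpoch q q * qpoch (z * q) q * ((1 - w) * qpoch (w * q) q)) by ring.
    rewrite <- E, Hz4, Hz3. replace a with (z + w) by (unfold w; ring).
    replace ((1 - w) * (theta1 (q ^ 5) - (1 + (z + w)) * q * theta2 (q ^ 5)))
      with ((1 - w) * theta1 (q ^ 5)
            + (w * w + z * w - 1 - z) * q * theta2 (q ^ 5)) by ring.
    rewrite Hzw. ring. }
  apply (f_equal (Cmult (/ (1 - w)))) in E'.
  rewrite !Cmult_assoc, Cinv_l, !Cmult_1_l in E' by trivial. exact E'.
Qed.

(** The root is [a/2 + i sqrt(1 - a^2/4)]; the equation for [a] keeps the radicand nonnegative. *)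
Lemma quadratic_unit_root (a : R) :
  (a * a + a = 1)%R -> exists z : C, Cmod z = 1%R /\ z * z - a * z + 1 = 0.
Proof.
  intros Ha.
  assert (Hs : (0 <= 1 - a / 2 * (a / 2))%R) by nra.
  exists (a / 2, sqrt (1 - a / 2 * (a / 2)))%R.
  pose proof (sqrt_sqrt _ Hs) as E. split.
  - unfold Cmod; transitivity (sqrt 1); [f_equal; simpl; lra | apply sqrt_1].
  - apply injective_projections; simpl; lra.
Qed.

(** Factor by factor with [x = q^(n+1)], this is [1 - x^5 = (1 - x)(1 - a1 x + x^2)(1 - a2 x +
    x^2)]. *)
Lemma qpoch_fifth_roots (q z1 z2 a1 a2 : C) :
  (Cmod q < 1)%R -> a1 + a2 = -1 -> a1 * a2 = -1 ->
  z1 * z1 - a1 * z1 + 1 = 0 -> z2 * z2 - a2 * z2 + 1 = 0 ->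
  qpoch q q * (qpoch (z1 * q) q * qpoch ((a1 - z1) * q) q)
    * (qpoch (z2 * q) q * qpoch ((a2 - z2) * q) q) = qpoch (q ^ 5) (q ^ 5).
Proof.
  intros Hq Hs Hp H1 H2.
  apply Clim_unique with (qpoch_n (q ^ 5) (q ^ 5)).
  2: now apply qpoch_Clim, Cmod_pow_lt_1.
  apply Clim_ext with (fun n => qpoch_n q q n
    * (qpoch_n (z1 * q) q n * qpoch_n ((a1 - z1) * q) q n)
    * (qpoch_n (z2 * q) q n * qpoch_n ((a2 - z2) * q) q n)).
  2: repeat apply Clim_mult; now apply qpoch_Clim.
  assert (Hf : forall a z x, z * z - a * z + 1 = 0 ->
            (1 - z * x) * (1 - (a - z) * x) = 1 - a * x + x * x).
  { intros a z x H.
    replace ((1 - z * x) * (1 - (a - z) * x))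
      with (1 - a * x + x * x - (z * z - a * z + 1) * (x * x)) by ring.
    rewrite H; ring. }
  induction n as [|n IH]; [simpl; ring|].
  cbn [qpoch_n]. rewrite <- IH.
  set (x := q * q ^ n).
  replace (q ^ 5 * (q ^ 5) ^ n) with (x ^ 5)
    by (unfold x; rewrite Cpow_mult_l, <- !Cpow_mult_r; f_equal; f_equal; lia).
  rewrite <- !(Cmult_assoc _ q (q ^ n)). fold x.
  assert (E : (1 - x) * ((1 - z1 * x) * (1 - (a1 - z1) * x))
                * ((1 - z2 * x) * (1 - (a2 - z2) * x)) = 1 - x ^ 5).
  { rewrite !Hf by trivial.
    replace ((1 - x) * (1 - a1 * x + x * x) * (1 - a2 * x + x * x))
      with ((1 - x) * (1 - (a1 + a2) * x + (a1 * a2 + 2) * x * x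
             - (a1 + a2) * x * x * x + x * x * x * x)) by ring.
    rewrite Hs, Hp. ring. }
  rewrite <- E. ring.
Qed.

Theorem euler_dissection5 (q : C) : in_punctured_disc q ->
  qpoch q q = qpoch (q ^ 25) (q ^ 25)
    * (rrG (q ^ 5) / rrH (q ^ 5) - q - q ^ 2 * (rrH (q ^ 5) / rrG (q ^ 5))).
Proof.
  intros Hq.
  assert (Hq0 : q <> 0) by (apply Cmod_gt_0, Hq).
  assert (HQ : in_punctured_disc (q ^ 5)).
  { split; [now apply Cmod_gt_0, Cpow_nz | apply Cmod_pow_lt_1, Hq]. }
  assert (Hroot : forall s : R, (s * s = 5)%R ->
            ((s - 1) / 2 * ((s - 1) / 2) + (s - 1) / 2 = 1)%R).
  { intros s Hs.
    replace ((s - 1) / 2 * ((s - 1) / 2) + (s - 1) / 2)%R with ((s * s - 1) / 4)%R by field.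
    rewrite Hs; lra. }
  assert (H5 : (sqrt 5 * sqrt 5 = 5)%R) by (apply sqrt_sqrt; lra).
  (* The two roots of [x^2 + x = 1], one for each conjugate pair of primitive fifth roots of
     unity. *)
  set (x1 := ((sqrt 5 - 1) / 2)%R). set (x2 := ((- sqrt 5 - 1) / 2)%R).
  assert (Hx1 : (x1 * x1 + x1 = 1)%R) by (apply Hroot; trivial).
  assert (Hx2 : (x2 * x2 + x2 = 1)%R) by (apply Hroot; lra).
  destruct (quadratic_unit_root x1 Hx1) as (z1 & Hz1 & E1).
  destruct (quadratic_unit_root x2 Hx2) as (z2 & Hz2 & E2).
  assert (T1 := theta_fifth_root q z1 x1 Hq Hz1
    ltac:(rewrite <- RtoC_mult, <- RtoC_plus, Hx1; trivial) E1).
  assert (T2 := theta_fifth_root q z2 x2 Hq Hz2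
    ltac:(rewrite <- RtoC_mult, <- RtoC_plus, Hx2; trivial) E2).
  assert (Hs : x1 + x2 = -1) by (rewrite <- RtoC_plus; f_equal; unfold x1, x2; lra).
  assert (Hp : x1 * x2 = -1).
  { rewrite <- RtoC_mult; f_equal. unfold x1, x2.
    replace ((sqrt 5 - 1) / 2 * ((- sqrt 5 - 1) / 2))%R
      with ((1 - sqrt 5 * sqrt 5) / 4)%R by field. rewrite H5; lra. }
  assert (P := qpoch_fifth_roots q z1 z2 x1 x2 (proj2 Hq) Hs Hp E1 E2).
  set (a := theta1 (q ^ 5)) in *. set (b := theta2 (q ^ 5)) in *.
  assert (K : qpoch q q * qpoch (q ^ 5) (q ^ 5) = a * a - q * a * b - q ^ 2 * b * b).
  { replace (a * a - q * a * b - q ^ 2 * b * b)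
      with ((a - (1 + x1) * q * b) * (a - (1 + x2) * q * b)).
    - rewrite T1, T2, <- P. ring.
    - replace ((a - (1 + x1) * q * b) * (a - (1 + x2) * q * b))
        with (a * a - (2 + (x1 + x2)) * q * a * b
              + (1 + (x1 + x2) + x1 * x2) * q ^ 2 * b * b) by ring.
      rewrite Hs, Hp. ring. }
  unfold a, b in K. rewrite theta1_rrG, theta2_rrH in K by trivial.
  assert (HE : qpoch (q ^ 5) (q ^ 5) <> 0) by now apply qpoch_pow5_nz.
  (* The classes 1 to 4 of [(q^5; q^5)_oo] form [1/(G H)]; this trades the base [q^5] in [K] for
     [q^25]. *)
  assert (EGH : qpoch (q ^ 25) (q ^ 25)
                = qpoch (q ^ 5) (q ^ 5) * rrG (q ^ 5) * rrH (q ^ 5)).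
  { rewrite (qpoch_split5 (q ^ 5)) by apply HQ. unfold rrG, rrH.
    replace (q ^ 25) with ((q ^ 5) ^ 5) by (now rewrite <- Cpow_mult_r).
    pose proof (qpoch_pow5_nz _ 0 HQ) as N1. rewrite Cpow_1_r in N1.
    pose proof (qpoch_pow5_nz _ 1 HQ). pose proof (qpoch_pow5_nz _ 2 HQ).
    pose proof (qpoch_pow5_nz _ 3 HQ).
    field; auto. }
  destruct (rr_nz _ HQ) as [HG HH]. rewrite EGH.
  replace (qpoch q q) with (/ qpoch (q ^ 5) (q ^ 5) * (qpoch q q * qpoch (q ^ 5) (q ^ 5)))
    by (field; trivial).
  rewrite K. field. auto.
Qed.

(** * Lambert series *)

(* For [d = 0] this is [0], since [/ 0 = 0]; hence the primed sums are instances of [Zsum]. *)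
Definition lambert (q : C) (e d s : Z) : C :=
  Cpowz (-1) s * Cpowz q e / (1 - Cpowz q d).

Lemma lambert_0 (q : C) (e s : Z) : lambert q e 0 s = 0.
Proof.
  unfold lambert, Cdiv, Cpowz at 3.
  assert (E : / (1 - 1) = RtoC 0).
  { apply injective_projections; simpl; unfold Rdiv; ring. }
  rewrite E. ring.
Qed.

(** For positive [d] use [|q^d| <= |q|]; for negative [d] use
    [|q^d| - 1 >= 1/|q| - 1 >= 1 - |q|]. *)
Lemma Cmod_1_minus_Cpowz (q : C) (d : Z) :
  in_punctured_disc q -> d <> 0%Z -> (1 - Cmod q <= Cmod (1 - Cpowz q d))%R.
Proof.
  intros [Hq0 Hq1] Hd. assert (Hq : q <> 0) by now apply Cmod_gt_0.
  destruct (Z_lt_le_dec d 0) as [Hneg|Hpos].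
  - replace d with (- Z.of_nat (S (Z.to_nat (- d - 1))))%Z by lia.
    set (n := Z.to_nat (- d - 1)). rewrite Cpowz_opp_nat by trivial.
    pose proof (Cmod_triangle 1 (/ q ^ S n - 1)) as T.
    replace (1 + (/ q ^ S n - 1)) with (/ q ^ S n) in T by ring.
    replace (1 - / q ^ S n) with (- (/ q ^ S n - 1)) by ring. rewrite Cmod_opp.
    rewrite Cmod_1, Cmod_inv, Cmod_pow in T by now apply Cpow_nz.
    assert (Hpw : (Cmod q ^ S n <= Cmod q ^ 1)%R) by (apply pow_antitone; [lra|lia]).
    rewrite pow_1 in Hpw.
    assert (Hinv : (/ Cmod q <= / Cmod q ^ S n)%R).
    { apply Rinv_le_contravar; trivial. now apply pow_lt. }
    assert (2 - Cmod q <= / Cmod q)%R.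
    { apply Rmult_le_reg_l with (Cmod q); trivial. rewrite Rinv_r by lra. nra. }
    lra.
  - replace d with (Z.of_nat (S (Z.to_nat (d - 1)))) by lia.
    set (n := Z.to_nat (d - 1)). rewrite Cpowz_of_nat.
    pose proof (Cmod_triangle (1 - q ^ S n) (q ^ S n)) as T.
    replace (1 - q ^ S n + q ^ S n) with (RtoC 1) in T by ring.
    rewrite Cmod_1, (Cmod_pow q) in T.
    assert (Hpw : (Cmod q ^ S n <= Cmod q ^ 1)%R) by (apply pow_antitone; [lra|lia]).
    rewrite pow_1 in Hpw. lra.
Qed.

(** Denominators are bounded below uniformly, and a zero denominator gives a zero term, so decay is
    decided by the numerator exponent. *)
Lemma lambert_geom_bounded (q : C) (e d s : Z -> Z) (c : Z) :
  in_punctured_disc q -> (forall m, Z.abs m <= e m + c)%Z ->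
  geom_bounded (Cmod q) (fun m => lambert q (e m) (d m) (s m)).
Proof.
  intros Hq He. pose proof Hq as [Hq0 Hq1].
  destruct (geom_bounded_Cpowz q 1 e c Hq) as [K HK]; [intros m; specialize (He m); lia|].
  rewrite Cpow_1_r in HK.
  exists (K / (1 - Cmod q))%R; intros m. specialize (HK m).
  assert (HK0 : (0 <= K * Cmod q ^ Z.abs_nat m)%R).
  { eapply Rle_trans; [apply Cmod_ge_0 | exact HK]. }
  replace (K / (1 - Cmod q) * Cmod q ^ Z.abs_nat m)%R
    with (K * Cmod q ^ Z.abs_nat m * / (1 - Cmod q))%R by (field; lra).
  destruct (Z.eq_dec (d m) 0) as [E|Hd].
  - rewrite E, lambert_0, Cmod_0.
    apply Rmult_le_pos; trivial. apply Rlt_le, Rinv_0_lt_compat; lra.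
  - pose proof (Cmod_1_minus_Cpowz q (d m) Hq Hd) as Hden.
    assert (Hnz : 1 - Cpowz q (d m) <> 0) by (apply Cmod_gt_0; lra).
    unfold lambert. rewrite Cmod_div, Cmod_mult, Cmod_Cpowz, Rmult_1_l
      by (trivial; exact Cmod_minus1).
    apply Rmult_le_compat; trivial using Cmod_ge_0.
    + apply Rlt_le, Rinv_0_lt_compat; lra.
    + apply Rinv_le_contravar; lra.
Qed.

Lemma lambert_pow5 (q : C) (e d s : Z) :
  q <> 0 -> lambert (q ^ 5) e d s = lambert q (5 * e) (5 * d) s.
Proof. intros Hq. unfold lambert. now rewrite !(Cpowz_pow q 5) by trivial. Qed.

Lemma lambert_shift (q : C) (c e d s : Z) :
  q <> 0 -> lambert q (c + e) d s = Cpowz q c * lambert q e d s.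
Proof. intros Hq. unfold lambert. rewrite Cpowz_add by trivial. unfold Cdiv; ring. Qed.

Lemma lambert_even (q : C) (e d s k : Z) : lambert q e d (s + 2 * k) = lambert q e d s.
Proof. unfold lambert. now rewrite Cpowz_minus1_even. Qed.

Lemma lambert_odd (q : C) (e d s k : Z) : lambert q e d (s + 2 * k + 1) = -1 * lambert q e d s.
Proof. unfold lambert. rewrite Cpowz_minus1_odd. unfold Cdiv; ring. Qed.

(** Recognises a residue class of a Lambert series in [q] as one in [q^5]: [c] is the power pulled
    out, and [h] witnesses that the sign is that of [m]. *)
Lemma Zsum_lambert_even (q : C) (e d s e' d' h : Z -> Z) (c : nat) (b : Z) :
  in_punctured_disc q -> (forall m, Z.abs m <= e' m + b)%Z ->
  (forall m, e m = Z.of_nat c + 5 * e' m)%Z -> (forall m, d m = 5 * d' m)%Z ->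
  (forall m, s m = m + 2 * h m)%Z ->
  Zsum (fun m => lambert q (e m) (d m) (s m))
  = q ^ c * Zsum (fun m => lambert (q ^ 5) (e' m) (d' m) m).
Proof.
  intros Hq Hb He Hd Hs. assert (Hq0 : q <> 0) by (apply Cmod_gt_0, Hq).
  assert (HQ : in_punctured_disc (q ^ 5)).
  { split; [now apply Cmod_gt_0, Cpow_nz | apply Cmod_pow_lt_1, Hq]. }
  rewrite <- (Zsum_scal (Cmod (q ^ 5))).
  - apply Zsum_ext; intros m. rewrite He, Hd, Hs.
    rewrite lambert_shift, lambert_even, Cpowz_of_nat, lambert_pow5 by trivial. reflexivity.
  - split; [apply Cmod_ge_0 | apply HQ].
  - now apply (lambert_geom_bounded (q ^ 5) e' d' (fun m => m) b).
Qed.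

Lemma Zsum_lambert_odd (q : C) (e d s e' d' h : Z -> Z) (c : nat) (b : Z) :
  in_punctured_disc q -> (forall m, Z.abs m <= e' m + b)%Z ->
  (forall m, e m = Z.of_nat c + 5 * e' m)%Z -> (forall m, d m = 5 * d' m)%Z ->
  (forall m, s m = m + 2 * h m + 1)%Z ->
  Zsum (fun m => lambert q (e m) (d m) (s m))
  = - q ^ c * Zsum (fun m => lambert (q ^ 5) (e' m) (d' m) m).
Proof.
  intros Hq Hb He Hd Hs. assert (Hq0 : q <> 0) by (apply Cmod_gt_0, Hq).
  assert (HQ : in_punctured_disc (q ^ 5)).
  { split; [now apply Cmod_gt_0, Cpow_nz | apply Cmod_pow_lt_1, Hq]. }
  rewrite <- (Zsum_scal (Cmod (q ^ 5))).
  - apply Zsum_ext; intros m. rewrite He, Hd, Hs.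
    rewrite lambert_shift, lambert_odd, Cpowz_of_nat, lambert_pow5 by trivial. ring.
  - split; [apply Cmod_ge_0 | apply HQ].
  - now apply (lambert_geom_bounded (q ^ 5) e' d' (fun m => m) b).
Qed.

(** With [x = q^n] and [T = n(n+1)/2], the index [n] gives [q^T (1 - 2x)/(1 - x^5)] and [-n] gives
    [q^T (2x^3 - x^4)/(1 - x^5)], up to the common sign. *)
Lemma lambert_fold (q : C) (n : nat) :
  in_punctured_disc q -> (0 < n)%nat ->
  (-1) ^ n * q ^ (n * (n + 1) / 2)%nat * (1 - q ^ n) ^ 3 * (1 + q ^ n) / (1 - q ^ (5 * n))
  = let f m := lambert q ((m * m + m) / 2) (5 * m) m
               + -2 * lambert q ((m * m + 3 * m) / 2) (5 * m) m in
    f (Z.of_nat n) + f (- Z.of_nat n)%Z.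
Proof.
  intros Hq Hn. assert (Hq0 : q <> 0) by (apply Cmod_gt_0, Hq).
  assert (HD : 1 - q ^ (5 * n) <> 0).
  { pose proof (Cmod_1_minus_Cpowz q (Z.of_nat (5 * n)) Hq ltac:(lia)) as H.
    rewrite Cpowz_of_nat in H. apply Cmod_gt_0. destruct Hq; lra. }
  set (T := (n * (n + 1) / 2)%nat).
  assert (HT : (2 * Z.of_nat T = Z.of_nat n * Z.of_nat n + Z.of_nat n)%Z).
  { unfold T. rewrite Nat2Z.inj_div, Nat2Z.inj_mul, Nat2Z.inj_add.
    quad_lia (Z.of_nat n). }
  cbv zeta. unfold lambert.
  replace ((Z.of_nat n * Z.of_nat n + Z.of_nat n) / 2)%Z with (Z.of_nat T)
    by (Z.to_euclidean_division_equations; lia).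
  replace ((Z.of_nat n * Z.of_nat n + 3 * Z.of_nat n) / 2)%Z with (Z.of_nat T + Z.of_nat n)%Z
    by (Z.to_euclidean_division_equations; lia).
  replace ((- Z.of_nat n * - Z.of_nat n + - Z.of_nat n) / 2)%Z
    with (Z.of_nat T + - Z.of_nat n)%Z by (Z.to_euclidean_division_equations; lia).
  replace ((- Z.of_nat n * - Z.of_nat n + 3 * - Z.of_nat n) / 2)%Z
    with (Z.of_nat T + - Z.of_nat n + - Z.of_nat n)%Z by (Z.to_euclidean_division_equations; lia).
  replace (5 * - Z.of_nat n)%Z with (- Z.of_nat (5 * n))%Z by lia.
  replace (5 * Z.of_nat n)%Z with (Z.of_nat (5 * n))%Z by lia.
  assert (Hsign : Cpowz (-1) (- Z.of_nat n) = (-1) ^ n).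
  { replace (- Z.of_nat n)%Z with (Z.of_nat n + 2 * - Z.of_nat n)%Z by lia.
    now rewrite Cpowz_minus1_even, Cpowz_of_nat. }
  rewrite !Hsign, !Cpowz_add, !Cpowz_opp_nat, !Cpowz_of_nat by trivial.
  rewrite (Nat.mul_comm 5), Cpow_mult_r in *. set (x := q ^ n) in *.
  assert (Hx : x <> 0) by (now apply Cpow_nz).
  field. repeat split; trivial.
  intros E. apply HD. replace (1 - x ^ 5) with (- (x ^ 5 - 1)) by ring. rewrite E; ring.
Qed.

(** * Assembling the five Lambert series identities *)

Theorem theorem4p2
  (h1 : forall q : C, in_punctured_disc q ->
     Zsum (fun m => Cpowz (-1) m * Cpowz q ((5 * m ^ 2 + 3 * m) / 2)
                     / (1 - Cpowz q (5 * m + 1)))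
     - Zsum (fun m => Cpowz (-1) m * Cpowz q ((5 * m ^ 2 - 3 * m) / 2)
                     / (1 - Cpowz q (5 * m - 2)))
     = qpoch (q ^ 5) (q ^ 5) ^ 2 * (rrG q ^ 2 / rrH q))
  (h2 : forall q : C, in_punctured_disc q ->
     Zsum (fun m => Cpowz (-1) m * Cpowz q ((5 * m ^ 2 + 5 * m) / 2)
                     / (1 - Cpowz q (5 * m + 1)))
     = qpoch (q ^ 5) (q ^ 5) ^ 2 * rrG q)
  (h3 : forall q : C, in_punctured_disc q ->
     Zsum (fun m => Cpowz (-1) m * Cpowz q ((5 * m ^ 2 + 5 * m) / 2)
                     / (1 - Cpowz q (5 * m + 2)))
     = qpoch (q ^ 5) (q ^ 5) ^ 2 * rrH q)
  (h4 : forall q : C, in_punctured_disc q ->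
     - Zsum (fun m => Cpowz (-1) m * Cpowz q ((5 * m ^ 2 + m - 2) / 2)
                     / (1 - Cpowz q (5 * m - 1)))
     + Zsum (fun m => Cpowz (-1) m * Cpowz q ((5 * m ^ 2 - m - 2) / 2)
                     / (1 - Cpowz q (5 * m - 2)))
     = qpoch (q ^ 5) (q ^ 5) ^ 2 * (rrH q ^ 2 / rrG q))
  (h5 : forall q : C, in_punctured_disc q ->
     - Zsum' (fun m => Cpowz (-1) m * Cpowz q ((5 * m ^ 2 + m - 2) / 2)
                     / (1 - Cpowz q (5 * m)))
     + Zsum (fun m => Cpowz (-1) m * Cpowz q ((5 * m ^ 2 - m - 2) / 2)
                     / (1 - Cpowz q (5 * m - 1)))
     + 2 * Zsum' (fun m => Cpowz (-1) m * Cpowz q ((5 * m ^ 2 + 3 * m - 2) / 2)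
                     / (1 - Cpowz q (5 * m)))
     + 2 * Zsum (fun m => Cpowz (-1) m * Cpowz q ((5 * m ^ 2 + 7 * m) / 2)
                     / (1 - Cpowz q (5 * m + 2)))
     = qpoch (q ^ 5) (q ^ 5) ^ 2 * (rrH q ^ 3 / rrG q ^ 2)) :
  forall q : C, in_punctured_disc q ->
    1 / qpoch q q *
      CSeries (fun k => let n := S k in
        (-1) ^ n * q ^ (n * (n + 1) / 2)%nat * (1 - q ^ n) ^ 3 * (1 + q ^ n)
        / (1 - q ^ (5 * n)))
    = - q * qpoch (q ^ 25) (q ^ 25) * rrG (q ^ 5)
      + q ^ 2 * qpoch (q ^ 25) (q ^ 25) * rrH (q ^ 5)
      + q ^ 3 * qpoch (q ^ 25) (q ^ 25) * (rrH (q ^ 5) ^ 2 / rrG (q ^ 5)).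

Proof.
  intros q Hq.
  assert (Hq0 : q <> 0) by (apply Cmod_gt_0, Hq).
  assert (Hr : (0 <= Cmod q < 1)%R) by (split; [apply Cmod_ge_0 | apply Hq]).
  assert (HQ : in_punctured_disc (q ^ 5)).
  { split; [now apply Cmod_gt_0, Cpow_nz | apply Cmod_pow_lt_1, Hq]. }
  assert (HrQ : (0 <= Cmod (q ^ 5) < 1)%R) by (split; [apply Cmod_ge_0 | apply HQ]).
  set (A := fun n => lambert q ((n * n + n) / 2) (5 * n) n).
  set (B := fun n => lambert q ((n * n + 3 * n) / 2) (5 * n) n).
  assert (HA : geom_bounded (Cmod q) A).
  { apply lambert_geom_bounded with 4%Z; trivial.
    intros m. pose proof (abs_square_le 2 m). quad_lia m. }
  assert (HB : geom_bounded (Cmod q) B).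
  { apply lambert_geom_bounded with 8%Z; trivial.
    intros m. pose proof (abs_square_le 3 m). quad_lia m. }
  pose (M := fun e d => Zsum (fun m => lambert (q ^ 5) (e m) (d m) m)).
  (* Each class is put in the exact shape of a sum in the hypotheses. The [-2] in an exponent
     accounts for a factor [q^5], and the classes 3 and 4 are first shifted by one to produce the
     denominators with [5m - 2] and [5m - 1]. *)
  assert (A0 : Zsum (fun m => A (5 * m)%Z)
    = q ^ 5 * M (fun m => (5 * m ^ 2 + m - 2) / 2)%Z (fun m => 5 * m)%Z).
  { apply Zsum_lambert_even with (h := fun m => (2 * m)%Z) (b := 20%Z); trivial;
      intros m; pose proof (abs_quad_le m); quad_lia m. }
  assert (A1 : Zsum (fun m => A (5 * m + 1)%Z)
    = - q ^ 1 * M (fun m => (5 * m ^ 2 + 3 * m) / 2)%Z (fun m => 5 * m + 1)%Z).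
  { apply Zsum_lambert_odd with (h := fun m => (2 * m)%Z) (b := 20%Z); trivial;
      intros m; pose proof (abs_quad_le m); quad_lia m. }
  assert (A2 : Zsum (fun m => A (5 * m + 2)%Z)
    = q ^ 3 * M (fun m => (5 * m ^ 2 + 5 * m) / 2)%Z (fun m => 5 * m + 2)%Z).
  { apply Zsum_lambert_even with (h := fun m => (2 * m + 1)%Z) (b := 20%Z); trivial;
      intros m; pose proof (abs_quad_le m); quad_lia m. }
  assert (A3 : Zsum (fun m => A (5 * m + 3)%Z)
    = q ^ 1 * M (fun m => (5 * m ^ 2 - 3 * m) / 2)%Z (fun m => 5 * m - 2)%Z).
  { rewrite (Zsum_pred (Cmod q)); [|trivial|apply Hq|apply geom_bounded_comp5; trivial; lia].
    apply Zsum_lambert_even with (h := fun m => (2 * m - 1)%Z) (b := 20%Z); trivial;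
      intros m; pose proof (abs_quad_le m); quad_lia m. }
  assert (A4 : Zsum (fun m => A (5 * m + 4)%Z)
    = - q ^ 5 * M (fun m => (5 * m ^ 2 - m - 2) / 2)%Z (fun m => 5 * m - 1)%Z).
  { rewrite (Zsum_pred (Cmod q)); [|trivial|apply Hq|apply geom_bounded_comp5; trivial; lia].
    apply Zsum_lambert_odd with (h := fun m => (2 * m - 1)%Z) (b := 20%Z); trivial;
      intros m; pose proof (abs_quad_le m); quad_lia m. }
  assert (B0 : Zsum (fun m => B (5 * m)%Z)
    = q ^ 5 * M (fun m => (5 * m ^ 2 + 3 * m - 2) / 2)%Z (fun m => 5 * m)%Z).
  { apply Zsum_lambert_even with (h := fun m => (2 * m)%Z) (b := 20%Z); trivial;
      intros m; pose proof (abs_quad_le m); quad_lia m. }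
  assert (B1 : Zsum (fun m => B (5 * m + 1)%Z)
    = - q ^ 2 * M (fun m => (5 * m ^ 2 + 5 * m) / 2)%Z (fun m => 5 * m + 1)%Z).
  { apply Zsum_lambert_odd with (h := fun m => (2 * m)%Z) (b := 20%Z); trivial;
      intros m; pose proof (abs_quad_le m); quad_lia m. }
  assert (B2 : Zsum (fun m => B (5 * m + 2)%Z)
    = q ^ 5 * M (fun m => (5 * m ^ 2 + 7 * m) / 2)%Z (fun m => 5 * m + 2)%Z).
  { apply Zsum_lambert_even with (h := fun m => (2 * m + 1)%Z) (b := 20%Z); trivial;
      intros m; pose proof (abs_quad_le m); quad_lia m. }
  assert (B3 : Zsum (fun m => B (5 * m + 3)%Z)
    = q ^ 4 * M (fun m => (5 * m ^ 2 - m - 2) / 2)%Z (fun m => 5 * m - 2)%Z).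
  { rewrite (Zsum_pred (Cmod q)); [|trivial|apply Hq|apply geom_bounded_comp5; trivial; lia].
    apply Zsum_lambert_even with (h := fun m => (2 * m - 1)%Z) (b := 20%Z); trivial;
      intros m; pose proof (abs_quad_le m); quad_lia m. }
  assert (B4 : Zsum (fun m => B (5 * m + 4)%Z)
    = - q ^ 4 * M (fun m => (5 * m ^ 2 + m - 2) / 2)%Z (fun m => 5 * m - 1)%Z).
  { rewrite (Zsum_pred (Cmod q)); [|trivial|apply Hq|apply geom_bounded_comp5; trivial; lia].
    apply Zsum_lambert_odd with (h := fun m => (2 * m - 1)%Z) (b := 20%Z); trivial;
      intros m; pose proof (abs_quad_le m); quad_lia m. }
  assert (HS : CSeries (fun k => let n := S k in
        (-1) ^ n * q ^ (n * (n + 1) / 2)%nat * (1 - q ^ n) ^ 3 * (1 + q ^ n)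
        / (1 - q ^ (5 * n))) = Zsum A + -2 * Zsum B).
  { rewrite <- (Zsum_scal (Cmod q)), <- (Zsum_plus (Cmod q))
      by (trivial; apply geom_bounded_scal; trivial; apply Hr).
    rewrite <- (CSeries_pairs (Cmod q)); trivial.
    - f_equal. apply functional_extensionality; intros k.
      exact (lambert_fold q (S k) Hq (Nat.lt_0_succ k)).
    - apply geom_bounded_plus; trivial. apply geom_bounded_scal; trivial. apply Hr.
    (* The index 0 contributes nothing because division by zero yields zero. *)
    - unfold A, B. rewrite !lambert_0. ring. }
  rewrite (Zsum_split5 (Cmod q) Hr A HA), (Zsum_split5 (Cmod q) Hr B HB) in HS.
  rewrite A0, A1, A2, A3, A4, B0, B1, B2, B3, B4 in HS.
  assert (H1 : M (fun m => (5 * m ^ 2 + 3 * m) / 2)%Z (fun m => 5 * m + 1)%Z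
               - M (fun m => (5 * m ^ 2 - 3 * m) / 2)%Z (fun m => 5 * m - 2)%Z
               = qpoch ((q ^ 5) ^ 5) ((q ^ 5) ^ 5) ^ 2 * (rrG (q ^ 5) ^ 2 / rrH (q ^ 5)))
    by exact (h1 _ HQ).
  assert (H2 : M (fun m => (5 * m ^ 2 + 5 * m) / 2)%Z (fun m => 5 * m + 1)%Z
               = qpoch ((q ^ 5) ^ 5) ((q ^ 5) ^ 5) ^ 2 * rrG (q ^ 5)) by exact (h2 _ HQ).
  assert (H3 : M (fun m => (5 * m ^ 2 + 5 * m) / 2)%Z (fun m => 5 * m + 2)%Z
               = qpoch ((q ^ 5) ^ 5) ((q ^ 5) ^ 5) ^ 2 * rrH (q ^ 5)) by exact (h3 _ HQ).
  assert (H4 : - M (fun m => (5 * m ^ 2 + m - 2) / 2)%Z (fun m => 5 * m - 1)%Z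
               + M (fun m => (5 * m ^ 2 - m - 2) / 2)%Z (fun m => 5 * m - 2)%Z
               = qpoch ((q ^ 5) ^ 5) ((q ^ 5) ^ 5) ^ 2 * (rrH (q ^ 5) ^ 2 / rrG (q ^ 5)))
    by exact (h4 _ HQ).
  assert (H5 : - M (fun m => (5 * m ^ 2 + m - 2) / 2)%Z (fun m => 5 * m)%Z
               + M (fun m => (5 * m ^ 2 - m - 2) / 2)%Z (fun m => 5 * m - 1)%Z
               + 2 * M (fun m => (5 * m ^ 2 + 3 * m - 2) / 2)%Z (fun m => 5 * m)%Z
               + 2 * M (fun m => (5 * m ^ 2 + 7 * m) / 2)%Z (fun m => 5 * m + 2)%Z
               = qpoch ((q ^ 5) ^ 5) ((q ^ 5) ^ 5) ^ 2 * (rrH (q ^ 5) ^ 3 / rrG (q ^ 5) ^ 2)).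
  { rewrite <- (h5 _ HQ).
    (* The same convention identifies the primed sums with the full sums collected in [M]. *)
    assert (Hprime : forall e : Z -> Z, (forall m, Z.abs m <= e m + 20)%Z ->
              M e (fun m => 5 * m)%Z = Zsum' (fun m => lambert (q ^ 5) (e m) (5 * m) m)).
    { intros e He. unfold M. symmetry. apply (Zsum'_Zsum (Cmod (q ^ 5)) HrQ).
      - now apply (lambert_geom_bounded _ e (fun m => 5 * m)%Z (fun m => m) 20).
      - apply lambert_0. }
    rewrite !Hprime; [reflexivity|..];
      intros m; pose proof (abs_quad_le m); quad_lia m. }
  destruct (rr_nz _ HQ) as [HG HH].
  assert (HE : qpoch q q <> 0) by (apply qpoch_nz; apply Hq).
  pose proof (euler_dissection5 q Hq) as HD.
  replace ((q ^ 5) ^ 5) with (q ^ 25) in * by (now rewrite <- Cpow_mult_r).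
  set (P := qpoch (q ^ 25) (q ^ 25)) in *.
  set (G := rrG (q ^ 5)) in *. set (H := rrH (q ^ 5)) in *.
  rewrite HS.
  match goal with |- _ * ?X = _ =>
    replace X with (qpoch q q * P * (- q * G + q ^ 2 * H + q ^ 3 * (H ^ 2 / G)))
  end.
  { field. auto. }
  rewrite HD.
  (* Expanding the product with the dissection leaves the five right-hand sides of the hypotheses
     with weights [-q], [2q^2], [q^3], [-2q^4], [-q^5], the same weights with which their left-hand
     sides occur in the split series. *)
  transitivity (P ^ 2 * (- q * (G ^ 2 / H)) + 2 * q ^ 2 * (P ^ 2 * G) + q ^ 3 * (P ^ 2 * H)
                - 2 * q ^ 4 * (P ^ 2 * (H ^ 2 / G)) - q ^ 5 * (P ^ 2 * (H ^ 3 / G ^ 2))).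
  { field. auto. }
  replace (P ^ 2 * (- q * (G ^ 2 / H))) with (- q * (P ^ 2 * (G ^ 2 / H))) by ring.
  rewrite <- H1, <- H2, <- H3, <- H4, <- H5. ring.
Qed.
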